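(* Given a Maya-Tupi graph $G$ with $n$ vertices and $m$ edges, and an MT-partition $(K,\overline{M},S,M)$ of $G$, an optimal proper coloring of $G$ (that is, a proper vertex coloring with $\chi(G)$ colors) can be computed in $\mathcal{O}(nm)$-time.
   Context: All graphs are finite and simple. An MT-partition $(K,\overline{M},S,M)$ of a graph $G$ is a partition of $V(G)$ into four (possibly empty) sets such that: $S$ is independent; $M$ induces a matching (a 1-regular graph); $\overline{M}$ induces a complete graph minus a perfect matching; $K$ is a clique; $S$ is anticomplete to $M$ (no edges between them); and $K$ is complete to $\overline{M}$ (all edges between them). A graph is Maya-Tupi if it admits an MT-partition. *)

(* Defs.v *)
From mathcomp Require Import all_boot.

Set Implicit Arguments.
Unset Strict Implicit.
Unset Printing Implicit Defensive.

Record sgraph (T : finType) := SGraph {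
  edge : rel T;
  edge_sym : symmetric edge;
  edge_irrefl : irreflexive edge }.

Section Graphs.
Variables (T : finType) (G : sgraph T).

Definition edges : {set {set T}} :=
  [set [set p.1; p.2] | p in [pred p : T * T | edge G p.1 p.2]].

Definition compl_edge : rel T := fun x y => (x != y) && ~~ edge G x y.

Lemma compl_edge_sym : symmetric compl_edge.
Proof. by move=> x y; rewrite /compl_edge eq_sym edge_sym. Qed.

Lemma compl_edge_irrefl : irreflexive compl_edge.
Proof. by move=> x; rewrite /compl_edge eqxx. Qed.

Definition compl : sgraph T := SGraph compl_edge_sym compl_edge_irrefl.

Definition independent (A : {set T}) : Prop :=
  {in A &, forall x y, ~~ edge G x y}.

Definition clique (A : {set T}) : Prop :=
  {in A &, forall x y, x != y -> edge G x y}.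

Definition complete_to (A B : {set T}) : Prop :=
  {in A & B, forall x y, edge G x y}.

Definition anticomplete_to (A B : {set T}) : Prop :=
  {in A & B, forall x y, ~~ edge G x y}.

Definition induces_matching (A : {set T}) : Prop :=
  {in A, forall x, #|[set y in A | edge G x y]| = 1}.

Definition colorable (k : nat) : bool :=
  [exists f : {ffun T -> 'I_k},
    [forall x, forall y, edge G x y ==> (f x != f y)]].

Lemma ex_colorable : exists k, colorable k.
Proof.
exists #|T|; apply/existsP; exists [ffun x => enum_rank x].
apply/forallP=> x; apply/forallP=> y; apply/implyP=> exy.
rewrite !ffunE (inj_eq enum_rank_inj).
by apply: contraTneq exy => ->; rewrite edge_irrefl.
Qed.

Definition chromatic_number : nat := ex_minn ex_colorable.

Definition proper_coloring (c : T -> nat) : Prop :=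
  forall x y, edge G x y -> c x <> c y.

(* Colors are numbered from 0, so [c x < chi] for all [x] means that at most
   (hence, by properness, exactly) chi colors are used. *)
Definition optimal_coloring (c : T -> nat) : Prop :=
  proper_coloring c /\ forall x, c x < chromatic_number.

End Graphs.

(* Being complete minus a perfect matching is being 1-regular in the
   complement; the counting clause says that the four possibly empty sets
   partition the vertices. *)
Definition MT_partition (T : finType) (G : sgraph T)
    (K Mbar S M : {set T}) : Prop :=
  (forall x, (x \in K) + (x \in Mbar) + (x \in S) + (x \in M) = 1) /\
  [/\ independent G S, induces_matching G M & induces_matching (compl G) Mbar]
  /\ [/\ clique G K, anticomplete_to G S M & complete_to G K Mbar].

Definition maya_tupi (T : finType) (G : sgraph T) : Prop :=
  exists K Mbar S M : {set T}, MT_partition G K Mbar S M.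

(* Structured programs over finitely many registers and arrays of natural
   numbers, with indirect addressing and unit cost per instruction and per
   test. The only arithmetic is successor and predecessor: t steps raise the
   largest value by at most t (up to the constants of the program), so unit
   cost cannot be abused by packing data into huge numbers. Every usual RAM
   simulates this machine with constant overhead per step. *)

Inductive test :=
  | TLt (x y : nat)
  | TEq (x y : nat).

Inductive program :=
  | Skip
  | Const (x k : nat)      (* x := k *)
  | Move (x y : nat)       (* x := y *)
  | Succ (x y : nat)       (* x := y + 1 *)
  | Pred (x y : nat)       (* x := y - 1, truncated at 0 *)
  | Read (x a y : nat)     (* x := a[y] *)
  | Write (a y x : nat)    (* a[y] := x *)
  | Seq (p q : program)
  | If (b : test) (p q : program)
  | While (b : test) (p : program).

Record state := State { reg : nat -> nat; arr : nat -> nat -> nat }.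

Definition upd (A : Type) (f : nat -> A) (i : nat) (v : A) : nat -> A :=
  fun j => if j == i then v else f j.

Definition set_reg (s : state) (x v : nat) : state :=
  State (upd (reg s) x v) (arr s).

Definition set_arr (s : state) (a i v : nat) : state :=
  State (reg s) (upd (arr s) a (upd (arr s a) i v)).

Definition eval (b : test) (s : state) : bool :=
  match b with
  | TLt x y => reg s x < reg s y
  | TEq x y => reg s x == reg s y
  end.

(* [exec p s t s']: from state s, program p halts in state s' after t steps. *)
Inductive exec : program -> state -> nat -> state -> Prop :=
  | ESkip s : exec Skip s 1 s
  | EConst s x k : exec (Const x k) s 1 (set_reg s x k)
  | EMove s x y : exec (Move x y) s 1 (set_reg s x (reg s y))
  | ESucc s x y : exec (Succ x y) s 1 (set_reg s x (reg s y).+1)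
  | EPred s x y : exec (Pred x y) s 1 (set_reg s x (reg s y).-1)
  | ERead s x a y : exec (Read x a y) s 1 (set_reg s x (arr s a (reg s y)))
  | EWrite s a y x : exec (Write a y x) s 1 (set_arr s a (reg s y) (reg s x))
  | ESeq p q s1 s2 s3 t u :
      exec p s1 t s2 -> exec q s2 u s3 -> exec (Seq p q) s1 (t + u) s3
  | EIfT b p q s s' t : eval b s -> exec p s t s' -> exec (If b p q) s t.+1 s'
  | EIfF b p q s s' t :
      ~~ eval b s -> exec q s t s' -> exec (If b p q) s t.+1 s'
  | EWhileF b p s : ~~ eval b s -> exec (While b p) s 1 s
  | EWhileT b p s1 s2 s3 t u :
      eval b s1 -> exec p s1 t s2 -> exec (While b p) s2 u s3 ->
      exec (While b p) s1 (t + u).+1 s3.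

Section Encoding.
Variable n : nat.

(* The neighbors may be listed in any order. *)
Definition adjacency_lists (G : sgraph 'I_n) (adj : 'I_n -> seq 'I_n) : Prop :=
  forall x, uniq (adj x) /\ adj x =i edge G x.

(* The lists are stored one after the other in array 1; that of vertex i
   occupies the cells from [offsets]_i (included) to [offsets]_i.+1 (excluded),
   where [offsets] is array 0. *)
Definition offsets (adj : 'I_n -> seq 'I_n) : seq nat :=
  mkseq (fun i => \sum_(x < n | x < i) size (adj x)) n.+1.

Definition neighbors (adj : 'I_n -> seq 'I_n) : seq nat :=
  flatten [seq [seq val y | y <- adj x] | x <- enum 'I_n].

Definition labels (K Mbar S M : {set 'I_n}) : seq nat :=
  [seq (x \in Mbar) * 1 + (x \in S) * 2 + (x \in M) * 3 | x <- enum 'I_n].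

(* Register 0 holds n; all cells not used by the input hold 0. *)
Definition input_state (adj : 'I_n -> seq 'I_n) (K Mbar S M : {set 'I_n}) :
    state :=
  State (fun x => if x == 0 then n else 0)
        (fun a => nth 0 (nth [::] [:: offsets adj; neighbors adj;
                                      labels K Mbar S M] a)).

(* The color of vertex x is read in cell x of array 3. *)
Definition output_coloring (s : state) : 'I_n -> nat := fun x => arr s 3 x.

End Encoding.

(* Main.v *)
Require Import Defs.
From mathcomp Require Import all_boot zify.

(* The core A = K u Mbar induces a complete multipartite graph with parts of
   size at most 2, so first-fit colors it with one color per part, q colors in
   all, and the graph is not colorable with fewer. Up to renaming the colors, a
   coloring with q colors extends this coloring of A, and a coloring with q + 1
   colors extends either it or the coloring obtained by giving a new color to
   one vertex of Mbar, since two split parts would force q + 2 colors; q + 2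
   colors always suffice, as S u M induces a bipartite graph. Whether a coloring
   of A extends is decided locally, because S u M induces isolated vertices and
   edges: every vertex needs a free color, and the ends x, y of an edge need
   distinct ones. If neither (least free color of x, greatest of y) nor (greatest
   of x, least of y) is a pair of distinct colors, then x and y have one and the
   same free color and nothing else.

   One attempt costs O(n (q + 1) + m), there are at most |A| + 3 attempts,
   q <= |A|, and |A| (|A| - 2) <= 2 m because the degree of a vertex of A is at
   least |A| - 2; hence the O(n m) bound. *)

Set Implicit Arguments.
Unset Strict Implicit.
Unset Printing Implicit Defensive.

(** * Total correctness with step bounds *)

(** Halting is part of the claim, and [T] is only an upper bound, so that budgets can be rounded up
    freely. *)
Definition runs (p : program) (s : state) (T : nat) (Q : state -> Prop) : Prop :=
  exists t s', [/\ exec p s t s', t <= T & Q s'].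

Lemma runs_weaken p s T T' (Q Q' : state -> Prop) :
  T <= T' -> (forall s', Q s' -> Q' s') -> runs p s T Q -> runs p s T' Q'.
Proof.
by move=> TT' QQ' [t [s' [ps tT /QQ' qs]]]; exists t, s'; split=> //; apply: leq_trans tT TT'.
Qed.

Lemma runs_leq p s T T' (Q : state -> Prop) : T <= T' -> runs p s T Q -> runs p s T' Q.
Proof. by move=> TT'; apply: runs_weaken TT' _. Qed.

Lemma runs_seq p q s T U (Q R : state -> Prop) :
  runs p s T Q -> (forall s', Q s' -> runs q s' U R) ->
  runs (Seq p q) s (T + U) R.
Proof.
move=> [t [s1 [ps tT Qs]]] /(_ _ Qs) [u [s2 [qs uU Rs]]].
by exists (t + u), s2; split=> //; [apply: ESeq ps qs | apply: leq_add].
Qed.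

Lemma runs_if b p q s T Q :
  (eval b s -> runs p s T Q) -> (~~ eval b s -> runs q s T Q) ->
  runs (If b p q) s T.+1 Q.
Proof.
move=> pP qP; have [bs|bs] := boolP (eval b s).
  have [t [s' [ps tT Qs]]] := pP bs.
  by exists t.+1, s'; split=> //; apply: EIfT.
have [t [s' [qs tT Qs]]] := qP bs.
by exists t.+1, s'; split=> //; apply: EIfF.
Qed.

(** * Loop-free programs *)

Fixpoint loopfree (p : program) : bool :=
  match p with
  | Seq p q | If _ p q => loopfree p && loopfree q
  | While _ _ => false
  | _ => true
  end.

Fixpoint cost (p : program) : nat :=
  match p with
  | Seq p q => cost p + cost q
  | If _ p q => (maxn (cost p) (cost q)).+1
  | _ => 1
  end.

(* Meaningful on loop-free programs only. *)
Fixpoint final (p : program) (s : state) : state :=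
  match p with
  | Const x k => set_reg s x k
  | Move x y => set_reg s x (reg s y)
  | Succ x y => set_reg s x (reg s y).+1
  | Pred x y => set_reg s x (reg s y).-1
  | Read x a y => set_reg s x (arr s a (reg s y))
  | Write a y x => set_arr s a (reg s y) (reg s x)
  | Seq p q => final q (final p s)
  | If b p q => if eval b s then final p s else final q s
  | Skip | While _ _ => s
  end.

Lemma runs_loopfree p s (Q : state -> Prop) :
  loopfree p -> Q (final p s) -> runs p s (cost p) Q.
Proof.
elim: p s Q => [|x k|x y|x y|x y|x a y|a y x|p IHp q IHq|b p IHp q IHq|//] s Q /=.
1-7: by move=> _ Qs; do 2!eexists; split; [econstructor| |exact: Qs].
- move=> /andP[lp lq] Qs; apply: (runs_seq (Q := eq (final p s))).
    exact: IHp.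
  by move=> _ <-; apply: IHq.
- move=> /andP[lp lq] Qs; apply: runs_if => bs; rewrite ?bs ?(negPf bs) in Qs.
    by apply: runs_weaken (IHp _ _ lp Qs) => //; rewrite leq_maxl.
  by apply: runs_weaken (IHq _ _ lq Qs) => //; rewrite leq_maxr.
Qed.

(** * Registers and arrays left unchanged *)

Fixpoint wregs (p : program) : seq nat :=
  match p with
  | Const x _ | Move x _ | Succ x _ | Pred x _ | Read x _ _ => [:: x]
  | Seq p q | If _ p q => wregs p ++ wregs q
  | While _ p => wregs p
  | Skip | Write _ _ _ => [::]
  end.

Fixpoint warrs (p : program) : seq nat :=
  match p with
  | Write a _ _ => [:: a]
  | Seq p q | If _ p q => warrs p ++ warrs q
  | While _ p => warrs p
  | _ => [::]
  end.

Definition frame (rs qs : seq nat) (s s' : state) : Prop :=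
  (forall r, r \notin rs -> reg s' r = reg s r) /\
  (forall a, a \notin qs -> arr s' a = arr s a).

Lemma frame_trans rs qs s1 s2 s3 :
  frame rs qs s1 s2 -> frame rs qs s2 s3 -> frame rs qs s1 s3.
Proof.
by move=> [r12 a12] [r23 a23]; split=> i ni; rewrite ?r23 ?a23 ?r12 ?a12.
Qed.

Lemma frame_sub rs qs rs' qs' s s' :
  {subset rs <= rs'} -> {subset qs <= qs'} -> frame rs qs s s' -> frame rs' qs' s s'.
Proof.
move=> rr qq [fr fa]; split=> i ni; [apply: fr | apply: fa].
  by apply: contra ni => /rr.
by apply: contra ni => /qq.
Qed.

(** What may change is read off the syntax, so loop invariants need not mention untouched registers
    and arrays. *)
Lemma exec_frame p s t s' : exec p s t s' -> frame (wregs p) (warrs p) s s'.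
Proof.
elim=> //=.
1-5: by move=> *; split=> // r; rewrite inE /= /upd => /negPf ->.
- by move=> *; split=> // r; rewrite inE /= /upd => /negPf ->.
- move=> p0 q s1 s2 s3 t0 u _ f1 _ f2; apply: (frame_trans (s2 := s2)).
    by apply: frame_sub f1 => i; rewrite mem_cat => ->.
  by apply: frame_sub f2 => i; rewrite mem_cat => ->; rewrite orbT.
- by move=> b p0 q s0 s1 t0 _ _ f; apply: frame_sub f => i; rewrite mem_cat => ->.
- by move=> b p0 q s0 s1 t0 _ _ f; apply: frame_sub f => i; rewrite mem_cat => ->; rewrite orbT.
- by move=> b p0 s1 s2 s3 t0 u _ _ f1 _ f2; apply: frame_trans f1 f2.
Qed.

Lemma runs_frame p s T (Q : state -> Prop) :
  runs p s T Q -> runs p s T (fun s' => Q s' /\ frame (wregs p) (warrs p) s s').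
Proof.
by move=> [t [s' [ps tT Qs]]]; exists t, s'; split=> //; split=> //; apply: exec_frame ps.
Qed.

(** * Counting loops *)

Definition up (i N : nat) (body : program) : program :=
  While (TLt i N) (Seq body (Succ i i)).

(** Each round pays 2 for the test and the increment, and the last failing test costs 1. The body
    must establish the invariant for the state in which the counter is already advanced. *)
Lemma runs_up i N body s (I : nat -> state -> Prop) (T : nat -> nat) :
  i \notin wregs body -> N \notin i :: wregs body ->
  reg s i <= reg s N -> I (reg s i) s ->
  (forall k s1, reg s i <= k < reg s N -> reg s1 i = k ->
     frame (i :: wregs body) (warrs body) s s1 -> I k s1 ->
     runs body s1 (T k) (fun s2 => I k.+1 (set_reg s2 i k.+1))) ->
  runs (up i N body) s (\sum_(reg s i <= k < reg s N) (T k + 2) + 1)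
    (fun s' => I (reg s N) s').
Proof.
move=> ib Nb; set lo := reg s i; set hi := reg s N => le_lohi Ilo step.
(* Induction on the number [d] of remaining rounds. *)
suff gen d k s1 : k + d = hi -> lo <= k -> reg s1 i = k ->
    frame (i :: wregs body) (warrs body) s s1 -> I k s1 ->
    runs (up i N body) s1 (\sum_(k <= j < hi) (T j + 2) + 1) (I hi).
  by apply: (gen (hi - lo) lo); rewrite ?subnKC.
elim: d k s1 => [|d IHd] k s1 kd lok s1i f1 Ik.
  rewrite addn0 in kd; rewrite -kd big_geq //; exists 1, s1; split=> //.
    by apply: EWhileF; rewrite /= s1i f1.1 // -/hi kd ltnn. 
have ltk : k < hi by rewrite -kd addnS ltnS leq_addr.
have lkh : lo <= k < hi by rewrite lok.
have [t [s2 [ex2 tT [I2 f2]]]] := runs_frame (step k s1 lkh s1i f1 Ik).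
have s2i : reg s2 i = k by rewrite f2.1.
have f3 : frame (i :: wregs body) (warrs body) s (set_reg s2 i k.+1).
  apply: frame_trans f1 _; split=> r nr /=; last by apply: f2.2.
  move: nr; rewrite inE negb_or => /andP[/negPf ri rb].
  by rewrite /upd ri; apply: f2.1.
have [||u [s3 [ex3 uT I3]]] := IHd k.+1 (set_reg s2 i k.+1) _ (leqW lok) _ f3 I2.
- by rewrite addSnnS.
- by rewrite /= /upd eqxx.
exists (t + 1 + u).+1, s3; split=> //.
  apply: EWhileT ex3; first by rewrite /= s1i f1.1.
  apply: ESeq ex2 _; rewrite -s2i; exact: ESucc.
by rewrite big_ltn //; lia.
Qed.

(** * Reading the input *)

Lemma sum_ltn_succ n (F : 'I_n -> nat) (x : 'I_n) :
  \sum_(y < n | y < x.+1) F y = \sum_(y < n | y < x) F y + F x.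
Proof.
rewrite (bigD1 x) //= addnC; congr (_ + _); apply: eq_bigl => y.
by rewrite ltnS [RHS]ltn_neqAle andbC.
Qed.

Lemma sum_ltn_take n (F : 'I_n -> nat) i : i <= n ->
  \sum_(y < n | y < i) F y = sumn (take i [seq F y | y <- enum 'I_n]).
Proof.
elim: i => [|i IHi] ltin; first by rewrite take0 big1.
rewrite (sum_ltn_succ _ (Ordinal ltin)) /= IHi 1?ltnW //.
have isz : i < size [seq F y | y <- enum 'I_n] by rewrite size_map size_enum_ord.
rewrite (take_nth 0) // sumn_rcons.
by rewrite (nth_map (Ordinal ltin)) ?size_enum_ord // -[i in RHS]/(val (Ordinal ltin)) nth_ord_enum.
Qed.

Section Input.
Variables (n : nat) (adj : 'I_n -> seq 'I_n).
Implicit Types (x y : 'I_n) (s : state).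

Lemma offsetsS x :
  nth 0 (offsets adj) x.+1 = nth 0 (offsets adj) x + size (adj x).
Proof.
have xn := ltn_ord x.
by rewrite /offsets !nth_mkseq ?ltnS // 1?ltnW // sum_ltn_succ.
Qed.

Lemma nth_neighbors x j : j < size (adj x) ->
  nth 0 (neighbors adj) (nth 0 (offsets adj) x + j) = nth x (adj x) j.
Proof.
move=> jx; have xn := ltn_ord x.
rewrite /offsets nth_mkseq ?ltnS 1?ltnW // (sum_ltn_take _ (ltnW xn)).
have sh : [seq size (adj y) | y <- enum 'I_n] =
    shape [seq [seq val y | y <- adj x] | x <- enum 'I_n].
  by rewrite /shape -map_comp; apply: eq_map => y /=; rewrite size_map.
(* The offsets are the prefix sums of the shape of the nested list, so the cell address is a
   [flatten_index]. *)
rewrite sh /neighbors nth_flatten -/(flatten_index _ x j).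
have xj : j < nth 0 (shape [seq [seq val y | y <- adj x] | x <- enum 'I_n]) x.
  by rewrite -sh (nth_map x) ?size_enum_ord // nth_ord_enum.
rewrite flatten_indexKl // flatten_indexKr //.
by rewrite (nth_map x) ?size_enum_ord // nth_ord_enum (nth_map x).
Qed.

Variable lab : seq nat.

Definition input_array a : seq nat := nth [::] [:: offsets adj; neighbors adj; lab] a.

(** The read-only part of the state: the constant registers and the three input arrays. *)
Definition loaded s : Prop :=
  [/\ reg s 0 = n, reg s 1 = 0, reg s 2 = 1, reg s 16 = 3 &
      forall a, a < 3 -> arr s a =1 nth 0 (input_array a)].

Lemma loaded_frame rs qs s s' :
  frame rs qs s s' -> all (fun r => r \notin rs) [:: 0; 1; 2; 16] ->
  all (fun a => a \notin qs) [:: 0; 1; 2] -> loaded s -> loaded s'.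
Proof.
move=> [fr fa] /and5P[r0 r1 r2 r3 _] /and4P[a0 a1 a2 _] [s0 s1 s2 s3 sa].
split; rewrite ?fr //.
by move=> [|[|[|//]]] lt3 i; rewrite fa // sa.
Qed.

End Input.

(* Registers: 0 = n, 1 = 0, 2 = 1, 16 = 3 (constants); 3 = number q of available
   colors; 4 = success flag of the last attempt; 5 = current vertex; 9 = current
   neighbor; 11, 12 = least and greatest free color; 14 = mate in M; 15 = label;
   20 = vertex of Mbar given a new color; the others are scratch.
   Arrays, besides the input and output ones: 4 = coloring of the core, with
   colors 1, ..., q, and 0 for uncolored vertices; 5 = marks on the colors seen
   by the current vertex; 6, 7 = least and greatest free color of each vertex, 0
   if there is none. *)
Definition nbrs (body : program) : program :=
  Seq (Seq (Read 7 0 5) (Seq (Succ 8 5) (Read 8 0 8)))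
      (up 7 8 (Seq (Read 9 1 7) body)).

(** The invariant is indexed by the neighbors visited so far and must ignore registers 7, 8 and 9,
    which drive the traversal. *)
Lemma runs_nbrs n (adj : 'I_n -> seq 'I_n) lab body s (x : 'I_n) c
    (I : seq 'I_n -> state -> Prop) :
  all (fun r => r \notin wregs body) [:: 0; 1; 2; 16; 5; 7; 8] ->
  all (fun a => a \notin warrs body) [:: 0; 1; 2] ->
  loaded adj lab s -> reg s 5 = x ->
  (forall l s1 s2, frame [:: 7; 8; 9] [::] s1 s2 -> I l s1 -> I l s2) ->
  I [::] s ->
  (forall l y s1, prefix (rcons l y) (adj x) ->
     frame (wregs (nbrs body)) (warrs (nbrs body)) s s1 -> reg s1 9 = y ->
     I l s1 -> runs body s1 c (I (rcons l y))) ->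
  runs (nbrs body) s ((c + 3) * size (adj x) + 4) (I (adj x)).
Proof.
move=> /and5P[b0 b1 b2 b16 /and4P[b5 b7 b8 _]] ba ld s5 Ifr I0 step.
have [ld0 ld1 ld2 ld16 lda] := ld.
have := @runs_loopfree (Seq (Read 7 0 5) (Seq (Succ 8 5) (Read 8 0 8))) s
   (fun s1 => [/\ reg s1 7 = nth 0 (offsets adj) x,
      reg s1 8 = nth 0 (offsets adj) x + size (adj x) & frame [:: 7; 8] [::] s s1]) isT.
case; first (split; rewrite /= /upd /= ?s5 ?lda //=).
- by rewrite -offsetsS.
- split=> // r; rewrite !inE !negb_or => /andP[/negPf r7 /negPf r8].
  by rewrite /= /upd r7 r8.
move=> t [s1 [ex1 /= t3 [s17 s18 f1]]].
suff H : runs (up 7 8 (Seq (Read 9 1 7) body)) s1 ((c + 3) * size (adj x) + 1) (I (adj x)).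
  have [u [s2 [ex2 tu I2]]] := H.
  exists (t + u), s2; split=> //; [apply: ESeq ex1 ex2 |].
  by rewrite addnC -[4]/(1 + 3) addnA leq_add.
(* The counter is an absolute address in array 1; subtracting the offset gives the length of the
   visited prefix. *)
pose I' k s := I (take (k - nth 0 (offsets adj) x) (adj x)) s.
have := @runs_up 7 8 (Seq (Read 9 1 7) body) s1 I' (fun=> c.+1).
rewrite s17 s18 => H; apply: runs_weaken (H _ _ _ _ _).
- by rewrite sum_nat_const_nat addKn addSnnS mulnC.
- by rewrite /I' => s'; rewrite addKn take_size.
- by rewrite /= inE b7.
- by rewrite /= !inE b8.
- exact: leq_addr.
- rewrite /I' subnn take0; apply: Ifr I0.
  by apply: frame_sub f1 => // i; rewrite !inE => /orP[] ->; rewrite ?orbT.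
move=> k s2 /andP[lok khi] s27 f2 Ik.
set o := nth 0 (offsets adj) x in lok khi Ik s17 s18 *.
have kx : k - o < size (adj x) by rewrite ltn_subLR.
have ld2' : loaded adj lab s2.
  apply: (loaded_frame f2) => //=; rewrite ?inE ?b0 ?b1 ?b2 ?b16 //.
  by apply: (loaded_frame f1).
set y := nth x (adj x) (k - o).
have s29 : arr s2 1 k = y.
  have [_ _ _ _ /(_ 1 isT k) ->] := ld2'.
  by rewrite -(subnKC lok) nth_neighbors.
rewrite -[c.+1]add1n; apply: runs_seq (_ : runs _ _ _ (eq (set_reg s2 9 y))) _.
  by apply: (@runs_loopfree (Read 9 1 7)) => //=; rewrite s27 s29.
move=> _ <-; rewrite /I' subSn // (take_nth x) // -/y.
have f29 : frame [:: 7; 8; 9] [::] s2 (set_reg s2 9 y).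
  split=> // r; rewrite !inE !negb_or => /and3P[_ _ /negPf r9].
  by rewrite /= /upd r9.
apply: (runs_weaken (leqnn c) _ (step (take (k - o) (adj x)) y _ _ _ _ _)) => //.
- move=> s3; apply: Ifr; split=> // r; rewrite !inE !negb_or => /and3P[/negPf r7 _ _].
  by rewrite /= /upd r7.
- by rewrite -take_nth // prefix_take.
- have sub : {subset [:: 7, 8, 9 & wregs body] <= wregs (nbrs body)}.
    by move=> i; rewrite /= !(inE, mem_cat) => /or4P[] ->; rewrite ?orbT.
  apply: (frame_trans (s2 := s1)); last apply: (frame_trans (s2 := s2)).
  + by apply: frame_sub f1 => // i; rewrite !inE => /orP[] ->; rewrite ?orbT.
  + apply: frame_sub f2 => i; rewrite /= !(inE, mem_cat); last by move->.
    by move=> /or3P[] ->; rewrite ?orbT.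
  + by apply: frame_sub f29 => // i; rewrite /= !(inE, mem_cat) => /or3P[] ->; rewrite ?orbT.
- by apply: Ifr Ik.
Qed.

(** * Free colors of a vertex *)

Definition for_ (i N : nat) (body : program) : program :=
  Seq (Const i 0) (up i N body).

Lemma runs_for i N body s (I : nat -> state -> Prop) (T : nat -> nat) :
  i \notin wregs body -> N \notin i :: wregs body -> I 0 (set_reg s i 0) ->
  (forall k s1, k < reg s N -> reg s1 i = k ->
     frame (i :: wregs body) (warrs body) s s1 -> I k s1 ->
     runs body s1 (T k) (fun s2 => I k.+1 (set_reg s2 i k.+1))) ->
  runs (for_ i N body) s (\sum_(0 <= k < reg s N) (T k + 2) + 2) (I (reg s N)).
Proof.
move=> ib Nb I0 step.
have NI : N != i by move: Nb; rewrite inE negb_or => /andP[].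
have si : reg (set_reg s i 0) i = 0 by rewrite /= /upd eqxx.
have sN : reg (set_reg s i 0) N = reg s N by rewrite /= /upd (negPf NI).
rewrite -[2]/(1 + 1) addnA [_ + 1]addnC.
apply: (runs_seq (Q := eq (set_reg s i 0))).
  by exists 1, (set_reg s i 0); split=> //; constructor.
move=> _ <-; have := @runs_up i N body (set_reg s i 0) I T ib Nb.
rewrite si sN; apply=> // k s1 lk s1i f1; apply: step => //.
apply: frame_trans f1; split=> // r; rewrite inE negb_or => /andP[/negPf ri _].
by rewrite /= /upd ri.
Qed.

Lemma runs_for_vertices n i body s (I : nat -> state -> Prop) (T : 'I_n -> nat) :
  i \notin wregs body -> 0 \notin i :: wregs body -> reg s 0 = n -> I 0 (set_reg s i 0) ->
  (forall (x : 'I_n) s1, reg s1 i = x ->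
     frame (i :: wregs body) (warrs body) s s1 -> I x s1 ->
     runs body s1 (T x) (fun s2 => I x.+1 (set_reg s2 i x.+1))) ->
  runs (for_ i 0 body) s (\sum_(x < n) (T x + 2) + 2) (I n).
Proof.
move=> ib Nb s0 I0 step.
(* The cost, defined on vertices only, is extended by 0 to all naturals. *)
have H := @runs_for i 0 body s I (fun k => if insub k is Some x then T x else 0) ib Nb I0.
rewrite s0 big_mkord in H; apply: (runs_weaken _ _ (H _)) => //.
  by rewrite leq_add2r leq_sum // => x _; rewrite valK.
by move=> k s1 lk s1i f1 Ik; rewrite insubT; apply: (step (Ordinal lk)).
Qed.

(** Three passes: clear the marks, mark the colors of the neighbors, scan for the least and greatest
    unmarked color. Counters start at 0 and colors at 1, whence [Succ 10 6]. *)
Definition free_colors : program :=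
  Seq (for_ 6 3 (Seq (Succ 10 6) (Write 5 10 1)))
 (Seq (nbrs (Seq (Read 10 4 9) (Write 5 10 2)))
 (Seq (Seq (Const 11 0) (Const 12 0))
      (for_ 6 3 (Seq (Succ 10 6) (Seq (Read 13 5 10)
        (If (TEq 13 1) (Seq (Move 12 10) (If (TEq 11 1) (Move 11 10) Skip)) Skip)))))).

(** Least and greatest elements of [fr] among the colors from 1 to [q]; the non-color 0 encodes that
    there is none. *)
Definition extremes (fr : pred nat) (q lo hi : nat) : Prop :=
  [/\ lo = 0, hi = 0 & forall c, 0 < c <= q -> ~~ fr c] \/
  [/\ 0 < lo, lo <= hi <= q, fr lo, fr hi & forall c, 0 < c <= q -> fr c -> lo <= c <= hi].

(** One step of the increasing scan: [lo] is set at the first free color only, [hi] at each one. *)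
Lemma extremesS fr k lo hi : extremes fr k lo hi ->
  extremes fr k.+1 (if fr k.+1 && (lo == 0) then k.+1 else lo) (if fr k.+1 then k.+1 else hi).
Proof.
have split_k c : 0 < c <= k.+1 -> 0 < c <= k \/ c = k.+1.
  by case/andP=> c0; rewrite leq_eqVlt ltnS => /orP[/eqP|ck]; [right | left; rewrite c0].
case=> [[-> -> nfr]|[lo0 /andP[lohi hik] frlo frhi ext]]; have [frk|nfrk] /= := boolP (fr k.+1).
- right; split=> //; first by rewrite leqnn.
  by move=> c /split_k[/nfr/negPf->|->]; rewrite ?leqnn.
- by left; split=> // c /split_k[/nfr|->].
- have lok := leq_trans lohi (leqW hik).
  right; rewrite (gtn_eqF lo0); split=> //; first by rewrite lok leqnn.
  move=> c /split_k[ck fc|->]; last by rewrite lok leqnn.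
  by have /andP[-> ci] := ext c ck fc; rewrite (leq_trans ci) // leqW.
- right; split=> //; first by rewrite lohi leqW.
  by move=> c /split_k[/ext|->] //; rewrite (negPf nfrk).
Qed.

Definition taken n (adj : 'I_n -> seq 'I_n) (col : nat -> nat) (x : 'I_n) : seq nat :=
  [seq col (val y) | y <- adj x].

Definition free n (adj : 'I_n -> seq 'I_n) (col : nat -> nat) (x : 'I_n) : pred nat :=
  fun c => c \notin taken adj col x.

Lemma runs_free_colors n (adj : 'I_n -> seq 'I_n) lab s (x : 'I_n) :
  loaded adj lab s -> reg s 5 = x ->
  runs free_colors s (20 * (reg s 3 + size (adj x) + 1))
    (fun s' => extremes (free adj (arr s 4) x) (reg s 3) (reg s' 11) (reg s' 12)).
Proof.
move=> ld s5; set q := reg s 3; set col := arr s 4.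
pose clear s' := forall c, 0 < c <= q -> arr s' 5 c = 0.
(* Cell 0 is left out: uncolored neighbors mark it, and it stands for no color. *)
pose marked (l : seq 'I_n) s' := forall c, 0 < c <= q ->
  (arr s' 5 c == 0) = (c \notin [seq col (val y) | y <- l]).
have [_ ld1 ld2 _ _] := ld.
apply: (@runs_weaken _ _ (\sum_(0 <= k < q) 4 + 2 +
  (((2 + 3) * size (adj x) + 4) + (2 + (\sum_(0 <= k < q) 8 + 2)))) _
  (fun s' => extremes (free adj col x) q (reg s' 11) (reg s' 12))) => //.
  by rewrite !sum_nat_const_nat subn0; lia.
apply: runs_seq.
  apply: (@runs_frame _ _ _ clear).
  pose I k s' := forall c, 0 < c <= k -> arr s' 5 c = 0.
  apply: (@runs_for 6 3 _ s I (fun=> 2)) => //; first by move=> c; rewrite leqn0 lt0n => /andP[/negPf->].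
  move=> k s1 kq s16 f1 Ik; apply: (@runs_loopfree (Seq _ _)) => // c ck.
  rewrite /= /upd /= s16 f1.1 // ld1; case: eqP => // /eqP ck1.
  by apply: Ik; move: ck ck1; lia.
move=> s1 [clear1 f1]; have ld1' := loaded_frame f1 isT isT ld.
apply: runs_seq.
  apply: (@runs_frame _ _ _ (marked (adj x))).
  apply: (runs_nbrs (I := marked) (x := x) _ _ ld1') => //.
  - by rewrite f1.1.
  - by move=> l s2 s3 [_ fa] m c cq; rewrite fa // m.
  - by move=> c cq; rewrite clear1.
  move=> l y s2 _ f2 s29 m; apply: (@runs_loopfree (Seq _ _)) => // c cq.
  rewrite /= /upd /= s29 f2.2 // f1.2 // f2.1 // f1.1 // ld2.
  rewrite map_rcons mem_rcons inE negb_or /col.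
  by case: (c == arr s 4 y) => //=; rewrite m.
move=> s2 [mk f2].
apply: (runs_seq (Q := fun s3 => [/\ reg s3 11 = 0, reg s3 12 = 0 & frame [:: 11; 12] [::] s2 s3])).
  apply: (@runs_loopfree (Seq _ _)) => //; split=> //; split=> // r.
  by rewrite !inE negb_or => /andP[/negPf r1 /negPf r2]; rewrite /= /upd r1 r2.
move=> s3 [s311 s312 f3].
have s33 : reg s3 3 = q by rewrite f3.1 // f2.1 // f1.1.
pose I k s' := extremes (free adj col x) k (reg s' 11) (reg s' 12).
apply: (@runs_weaken _ _ (\sum_(0 <= k < reg s3 3) 8 + 2) _ (I (reg s3 3))).
- by rewrite s33.
- by rewrite /I s33.
apply: (@runs_for 6 3 _ s3 I (fun=> 6)) => //.
  by left; split=> // c; case: c.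
move=> k s4; rewrite s33 => kq s46 f4 Ik; apply: (@runs_loopfree (Seq _ _)) => //.
have := extremesS Ik.
have frk : free adj col x k.+1 = (arr s4 5 k.+1 == 0).
  by rewrite f4.2 // f3.2 // mk.
have s41 : reg s4 1 = 0 by rewrite f4.1 // f3.1 // f2.1 // f1.1.
rewrite /I /= /upd /= s46 frk s41.
by case: (arr s4 5 k.+1 == 0) => //=; case: (reg s4 11 == 0).
Qed.

(** * Coloring the core *)

(** Labels below 2 are those of the core. When register 11 reports no free color, a new one is
    opened in register 3. *)
Definition color_core : program :=
  for_ 5 0 (Seq (Read 15 2 5) (If (TLt 2 15) Skip
    (Seq free_colors
         (Seq (If (TEq 11 1) (Seq (Succ 3 3) (Move 11 3)) Skip) (Write 4 5 11))))).

Lemma sum_mem (T : finType) (A : {set T}) : \sum_x (x \in A : nat) = #|A|.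
Proof. by rewrite -sum1_card [RHS]big_mkcond; apply: eq_bigr => x _; case: (x \in A). Qed.

Lemma sum_affine (T : finType) (f g : T -> nat) a b c :
  \sum_x (f x * a + g x * b + c) = (\sum_x f x) * a + (\sum_x g x) * b + #|T| * c.
Proof. by rewrite !big_split /= sum_nat_const -!big_distrl. Qed.

Section Core.
Variables (n : nat) (G : sgraph 'I_n) (adj : 'I_n -> seq 'I_n) (lab : seq nat).
Implicit Types (x y z : 'I_n) (s : state).

Definition label x : nat := nth 0 lab x.
Definition core : {set 'I_n} := [set x | label x < 2].

Lemma in_core x : (x \in core) = (label x < 2).
Proof. by rewrite inE. Qed.

Hypothesis adjP : adjacency_lists G adj.
Hypothesis core_class : forall x y z, x \in core -> y \in core -> z \in core ->
  ~~ edge G x y -> ~~ edge G x z -> x != y -> x != z -> y = z.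

(* State of the first-fit coloring when the vertices below [k] are done. *)
Definition multipartite_coloring (k : nat) (col : nat -> nat) (q : nat) : Prop :=
  [/\ forall x, x \in core -> x < k -> 0 < col x <= q,
      forall x, ~~ ((x \in core) && (x < k)) -> col x = 0,
      forall x y, x \in core -> y \in core -> x < k -> y < k ->
        (col x == col y) = ~~ edge G x y
    & forall c, 0 < c <= q -> exists x, [/\ x \in core, x < k & col x = c]].

(** Two vertices of the core other than [y] and nonadjacent to it coincide. Nonadjacency is thus an
    equivalence on the core, whose classes are the parts. *)
Lemma core_trans x y z : x \in core -> y \in core -> z \in core ->
  ~~ edge G x y -> ~~ edge G y z -> ~~ edge G x z.
Proof.
move=> xA yA zA; have [->//|nxy] := eqVneq x y; have [<-//|nyz] := eqVneq y z.
rewrite edge_sym eq_sym in nxy * => xy yz.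
by rewrite (core_class yA xA zA xy yz nxy nyz) edge_irrefl.
Qed.

Lemma mem_taken (col : nat -> nat) x c : c \in taken adj col x -> exists2 y, edge G x y & c = col y.
Proof. by move=> /mapP[y]; rewrite (adjP x).2 => xy ->; exists y. Qed.

Lemma taken_edge (col : nat -> nat) x y : edge G x y -> col y \in taken adj col x.
Proof. by move=> xy; apply/mapP; exists y; rewrite ?(adjP x).2. Qed.

Lemma leq_card_core k col q : multipartite_coloring k col q -> q <= #|core|.
Proof.
move=> [_ _ _ ex]; rewrite -(size_iota 1 q) cardE -(size_map (fun x => col (val x))).
apply: uniq_leq_size (iota_uniq _ _) _ => c; rewrite mem_iota add1n ltnS => /ex[x [xA _ <-]].
by apply/mapP; exists x; rewrite ?mem_enum.
Qed.

(** First-fit puts [x] into its part: a used color that is free for [x] is carried by some vertex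
    nonadjacent to [x], and if no color is free then [x] opens a new part. *)
Lemma multipartite_coloringS (col : nat -> nat) q lo hi x :
  x \in core -> multipartite_coloring x col q ->
  extremes (free adj col x) q lo hi ->
  multipartite_coloring x.+1 (upd col x (if lo == 0 then q.+1 else lo))
    (if lo == 0 then q.+1 else q).
Proof.
move=> xA [rng zer ker ex] ext.
have updE (y : 'I_n) v : upd col x v y = if y == x then v else col y by [].
set v := if lo == 0 then q.+1 else lo; set q' := if lo == 0 then q.+1 else q.
have qq' : q <= q' by rewrite /q'; case: ifP.
have lt_x (y : 'I_n) : y < x.+1 -> y != x -> y < x.
  by move=> yx nyx; rewrite ltn_neqAle -ltnS yx andbT.
have vq : 0 < v <= q'.
  rewrite /v /q'; case: ext => [[-> _ _]|[lo0 /andP[lohi hiq] _ _ _]]; first by rewrite /= leqnn.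
  by rewrite (gtn_eqF lo0) lo0 (leq_trans lohi).
(* The crux: the new color meets an old one exactly on the part of [x]. Freeness of the color of [y]
   follows because a neighbor of [x] sharing it would be in the part of [y], hence in that of
   [x]. *)
have vP (y : 'I_n) : y \in core -> y < x -> (col y == v) = ~~ edge G x y.
  move=> yA yx; have cyq := rng y yA yx.
  have fr : ~~ edge G x y -> free adj col x (col y).
    move=> nxy; apply/negP => /mem_taken[z xz cyz].
    have /andP[zA zx] : (z \in core) && (z < x).
      by apply: contraLR cyq => /zer z0; rewrite cyz z0.
    have := ker y z yA zA yx zx; rewrite cyz eqxx => /esym nyz.
    by have := core_trans xA yA zA nxy nyz; rewrite xz.
  rewrite /v; case: ext => [[-> _ nfr]|[lo0 /andP[lohi hiq] frlo _ _]].
    have /andP[_ cq] := cyq; rewrite eqxx (ltn_eqF (cq : _ < q.+1)).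
    by apply/esym/negbTE/negP => /fr; apply/negP/nfr.
  rewrite (gtn_eqF lo0); apply/idP/idP => [/eqP cy|nxy].
    by apply: contraL frlo => xy; rewrite /free negbK -cy taken_edge.
  have [|z [zA zx cz]] := ex lo; first by rewrite lo0 (leq_trans lohi).
  rewrite -cz ker //; apply: (@core_trans y x z) => //; first by rewrite edge_sym.
  by apply: contraL frlo => xz; rewrite /free negbK -cz taken_edge.
split.
- move=> y yA yx; rewrite updE; have [_//|nyx] := eqVneq y x.
  by have /andP[-> /leq_trans->] := rng y yA (lt_x y yx nyx).
- move=> y nyA; rewrite updE; have [yx|nyx] := eqVneq y x.
    by rewrite yx xA ltnSn in nyA.
  by apply: zer; apply: contra nyA => /andP[-> yx] /=; apply: leqW.
- move=> y z yA zA yx zx; rewrite !updE.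
  have [->|nyx] := eqVneq y x; have [->|nzx] := eqVneq z x.
  + by rewrite eqxx edge_irrefl.
  + by rewrite eq_sym vP // lt_x.
  + by rewrite vP ?lt_x // edge_sym.
  + by rewrite ker ?lt_x.
- move=> c cq.
  have old : 0 < c <= q -> exists y, [/\ y \in core, y < x.+1 & upd col x v y = c].
    move=> /ex[y [yA yx yc]]; exists y; split=> //; first exact: leqW.
    by rewrite updE -val_eqE (ltn_eqF yx).
  move: cq; rewrite /q'; have [lo0|_ //] := eqVneq lo 0.
  case/andP=> c0; rewrite leq_eqVlt => /orP[/eqP cq|cq]; last by apply: old; rewrite c0.
  by exists x; rewrite ltnSn updE eqxx /v lo0 eqxx.
Qed.

Lemma runs_color_core s :
  loaded adj lab s -> reg s 3 = 0 -> (forall i, arr s 4 i = 0) ->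
  runs color_core s
    (20 * (#|core| * (#|core| + 1) + \sum_x size (adj x)) + 12 * n + 2)
    (fun s' => multipartite_coloring n (arr s' 4) (reg s' 3)).
Proof.
move=> ld s3 s4; have [ld0 _ _ _ _] := ld.
(* Only vertices of the core pay for scanning the colors, of which there are at most [#|core|]. *)
pose T x := 1 + ((x \in core) * (20 * (#|core| + 1)) + 20 * size (adj x) + 9).
pose I k s' := multipartite_coloring k (arr s' 4) (reg s' 3).
have HI : runs color_core s (\sum_(x < n) (T x + 2) + 2) (I n).
  apply: runs_for_vertices => //.
    by split=> //= c; rewrite /upd /= s3; case: c.
  move=> x s1 s15 f1 Ix.
  have [_ _ ld2 _ lda] : loaded adj lab s1 := loaded_frame f1 isT isT ld.
  rewrite /T.
  apply: (runs_seq (Q := eq (set_reg s1 15 (label x)))).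
    by apply: (@runs_loopfree (Read 15 2 5)) => //=; rewrite s15 lda.
  move=> _ <-; have x_lt (y : 'I_n) : (y < x.+1) = (y == x) || (y < x).
    by rewrite ltnS leq_eqVlt.
  have [xA|nxA] := boolP (x \in core); last first.
    rewrite mul0n add0n; apply: (@runs_leq _ _ 2) => //; first by rewrite !addnS.
    apply: runs_if => /= [_|]; last by rewrite /upd /= ld2 -leqNgt -ltnS -in_core (negPf nxA).
    apply: (@runs_loopfree Skip) => //; rewrite /I /upd /=.
    case: Ix => rng zer ker ex; split.
    - by move=> y yA; rewrite x_lt => /orP[/eqP yx|]; [rewrite yx (negPf nxA) in yA | apply: rng].
    - by move=> y; rewrite x_lt => nyA; apply: zer; apply: contra nyA => /andP[-> ->]; rewrite orbT.
    - move=> y z yA zA; rewrite !x_lt => /orP[/eqP yx|yx]; first by rewrite yx (negPf nxA) in yA.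
      by move=> /orP[/eqP zx|zx]; [rewrite zx (negPf nxA) in zA | apply: ker].
    - by move=> c /ex[y [yA yx yc]]; exists y; split=> //; apply: leqW.
  set s2 := set_reg s1 15 _; have ld' : loaded adj lab s2 := loaded_frame f1 isT isT ld.
  have qA := leq_card_core Ix.
  apply: (@runs_leq _ _ (20 * (reg s2 3 + size (adj x) + 1) + 4).+1).
    by rewrite mul1n /s2 /= /upd /=; move: (reg _ _) #|core| (size _) qA => q a d; clear; lia.
  apply: runs_if => /= [|_]; first by rewrite /upd /= ld2 ltnNge -ltnS -in_core xA.
  apply: runs_seq (runs_frame (runs_free_colors ld' _)) _ => //=.
  move=> s3' [ext f3]; apply: (@runs_loopfree (Seq _ _)) => //.
  have s1x : reg s3' 5 = x by rewrite f3.1 //= /upd /= s15.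
  have s13 : reg s3' 3 = reg s1 3 by rewrite f3.1.
  have s11 : reg s3' 1 = 0 by have [_ -> _ _ _] := loaded_frame f3 isT isT ld'.
  have s14 : arr s3' 4 = arr s1 4 by rewrite f3.2.
  have := multipartite_coloringS xA Ix ext.
  rewrite /I /= /upd /= s11.
  by case: (reg s3' 11 == 0); rewrite /= /upd /= ?s1x ?s14 ?s13.
apply: runs_weaken HI => //.
have TE x : T x + 2 = (x \in core) * (20 * (#|core| + 1)) + size (adj x) * 20 + 12.
  by rewrite /T; move: (_ * (20 * _)) (size (adj x)) => a d; clear; lia.
rewrite (eq_bigr _ (fun x _ => TE x)) sum_affine sum_mem card_ord.
by move: (\sum_x size _) #|core| => d a; clear; lia.
Qed.
End Core.

(** * Extending a coloring of the core *)

Definition extremal_colors : program :=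
  for_ 5 0 (Seq (Read 15 2 5) (If (TLt 2 15)
    (Seq free_colors
      (Seq (Write 6 5 11) (Seq (Write 7 5 12) (If (TEq 11 1) (Const 4 0) Skip))))
    Skip)).

Definition find_mate : program :=
  Seq (Move 14 5) (nbrs (Seq (Read 10 2 9) (If (TEq 10 16) (Move 14 9) Skip))).

(** Registers 11, 12 hold the extreme free colors of the vertex, 17, 18 those of its mate. Only the
    smaller end reports a clash; [Pred] shifts the colors to start at 0. *)
Definition choose_color : program :=
  Seq (Seq (Read 11 6 5) (Seq (Read 12 7 5) (Seq (Read 17 6 14) (Read 18 7 14))))
 (Seq (If (TLt 5 14)
        (If (TEq 11 18) (Seq (If (TEq 12 17) (Const 4 0) Skip) (Move 11 12)) Skip)
        (If (TEq 17 12) Skip (Move 11 12)))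
      (Seq (Pred 11 11) (Write 3 5 11))).

Definition copy_color : program := Seq (Read 11 4 5) (Seq (Pred 11 11) (Write 3 5 11)).

Definition color_all : program :=
  for_ 5 0 (Seq (Read 15 2 5) (If (TLt 2 15) (Seq find_mate choose_color) copy_color)).

Definition extend : program := Seq (Const 4 1) (Seq extremal_colors color_all).

Section Extend.
Variables (n : nat) (G : sgraph 'I_n) (adj : 'I_n -> seq 'I_n) (lab : seq nat).
Implicit Types (x y z w : 'I_n) (s : state).

Local Notation label := (@label n lab).
Local Notation core := (core n lab).

Hypothesis adjP : adjacency_lists G adj.
Hypothesis outer_edge : forall x y, x \notin core -> y \notin core -> edge G x y -> label x = 3.
Hypothesis matched : forall x y z, label x = 3 -> label y = 3 -> label z = 3 ->
  edge G x y -> edge G x z -> y = z.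

Lemma mem_adj x y : (y \in adj x) = edge G x y.
Proof. by rewrite (adjP x).2. Qed.

Lemma matched_notin_core x : label x = 3 -> x \notin core.
Proof. by rewrite in_core => ->. Qed.

(* The neighbor labelled M, and the vertex itself by default; a vertex of S is its
   own mate. *)
Definition mate_from (w : 'I_n) (l : seq 'I_n) : 'I_n :=
  foldl (fun w y => if label y == 3 then y else w) w l.

Definition mate x : 'I_n := mate_from x (adj x).

Lemma mate_from_rcons w l y :
  mate_from w (rcons l y) = if label y == 3 then y else mate_from w l.
Proof. by rewrite /mate_from foldl_rcons. Qed.

Lemma mate_fromP w l :
  mate_from w l = w /\ (forall y, y \in l -> label y <> 3) \/
  mate_from w l \in l /\ label (mate_from w l) = 3.
Proof.
elim/last_ind: l => [|l y IHl]; first by left.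
rewrite mate_from_rcons; case: eqP => [y3|ny3].
  by right; rewrite mem_rcons mem_head.
case: IHl => [[-> nl]|[wl w3]]; [left | right]; split=> //.
  by move=> z; rewrite mem_rcons inE => /orP[/eqP->|/nl].
by rewrite mem_rcons inE wl orbT.
Qed.

Lemma mate_edge x y : x \notin core -> y \notin core -> edge G x y -> mate x = y.
Proof.
move=> xA yA xy; have x3 := outer_edge xA yA xy.
have y3 : label y = 3 by apply: (outer_edge yA xA); rewrite edge_sym.
case: (mate_fromP x (adj x)) => [[_ nl]|[xw w3]].
  by case: (nl y) => //; rewrite mem_adj.
by apply: (matched x3 w3 y3) => //; rewrite -mem_adj.
Qed.

Lemma mate_neq x : mate x != x -> edge G x (mate x) /\ mate x \notin core.
Proof.
rewrite /mate; case: (mate_fromP x (adj x)) => [[-> _]|[xw w3] _]; first by rewrite eqxx.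
by split; [rewrite -mem_adj | apply: matched_notin_core].
Qed.

Definition precoloring (col : nat -> nat) q : Prop :=
  [/\ forall x, x \in core -> 0 < col x <= q,
      forall x, x \notin core -> col x = 0
    & forall x y, x \in core -> y \in core -> edge G x y -> col x <> col y].

Definition extendable (col : nat -> nat) q : Prop :=
  exists c : 'I_n -> nat, [/\ forall x, 0 < c x <= q, proper_coloring G c
    & forall x, x \in core -> c x = col x].

(** * Choosing colors at the ends of an edge outside the core *)

Section Choice.
Variables (col lo hi : nat -> nat) (q : nat).

(** The smaller end prefers its least color, the larger its greatest. Both ends evaluate the same
    test, so their separate decisions agree. A vertex that is its own mate takes the second branch,
    where either value will do. *)
Definition choice x : nat :=
  let w := mate x in
  if x < w then if lo x == hi w then hi x else lo x
  else if lo w == hi x then lo x else hi x.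

Definition clash x : bool :=
  let w := mate x in [&& x < w, lo x == hi w & hi x == lo w].

Definition stuck : Prop :=
  exists2 x, x \notin core & (lo x == 0) || clash x.

Hypothesis pre : precoloring col q.
Hypothesis lohi : forall x, x \notin core -> extremes (free adj col x) q (lo x) (hi x).

(** At a clash with mate [w], an extension would satisfy [c x <= hi x = lo w <= c w <= hi w = lo x
    <= c x], so adjacent vertices would share a color. *)
Lemma stuck_not_extendable : stuck -> ~ extendable col q.
Proof.
move=> [x xA st] [c [cq cP cA]].
have fr (y : 'I_n) : y \notin core -> free adj col y (c y).
  move=> yA; apply/negP => /(mem_taken adjP)[z yz cz]; have [zA|zA] := boolP (z \in core).
    by apply: (cP y z yz); rewrite cz cA.
  (* A neighbor outside the core has [col] equal to 0, but [c y] is positive. *)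
  by have := cq y; rewrite cz; case: pre => _ -> //.
have bnd (y : 'I_n) : y \notin core -> 0 < lo y /\ lo y <= c y <= hi y.
  move=> yA; case: (lohi yA) => [[_ _ nfr]|[l0 _ _ _ b]].
    by have := nfr (c y) (cq y); rewrite fr.
  by split=> //; apply: b => //; apply: fr.
have [x0 /andP[lx hx]] := bnd x xA; move: st; rewrite (gtn_eqF x0) /= => /and3P[xw /eqP lh /eqP hl].
have nwx : mate x != x by rewrite -val_eqE (gtn_eqF xw).
have [xwE wA] := mate_neq nwx.
have [_ /andP[lw hw]] := bnd _ wA.
by apply: (cP _ _ xwE); apply/eqP; rewrite eqn_leq (leq_trans hx) ?hl //= (leq_trans hw) // -lh.
Qed.

Definition full_coloring x : nat := if x \in core then col x else choice x.

Lemma choice_free x : ~ stuck -> x \notin core -> 0 < choice x <= q /\ free adj col x (choice x).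
Proof.
move=> nst xA; case: (lohi xA) => [[l0 _ _]|[l0 /andP[lh hq] fl fh _]].
  by case: nst; exists x; rewrite ?l0.
have lq := leq_trans lh hq; have h0 := leq_trans l0 lh.
by rewrite /choice; do 2!case: ifP; rewrite ?l0 ?h0 ?lq ?hq.
Qed.

Lemma full_coloring_proper : ~ stuck -> proper_coloring G full_coloring.
Proof.
move=> nst; have mix (x y : 'I_n) : x \notin core -> y \in core -> edge G x y ->
    choice x <> col y.
  move=> xA yA xy cxy; have [_] := choice_free nst xA; rewrite cxy /free.
  by rewrite (taken_edge adjP).
have out (x y : 'I_n) : x \notin core -> y \notin core -> edge G x y -> x < y ->
    choice x <> choice y.
  (* Once each end is named as the mate of the other, both tests read [lo x == hi y]; if it holds,
     equal choices mean a clash. *)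
  move=> xA yA xy ltxy; rewrite /choice (mate_edge xA yA xy).
  rewrite (mate_edge yA xA) 1?edge_sym // ltxy ltnNge ltnW //=.
  case: eqP => // lh; move=> hl; apply: nst; exists x => //.
  by rewrite /clash (mate_edge xA yA xy) ltxy lh hl !eqxx orbT.
move=> x y xy; rewrite /full_coloring; case: ifPn => xA; case: ifPn => yA.
- by case: pre => _ _; apply.
- by move=> e; apply: (mix y x yA xA); rewrite ?e // edge_sym.
- exact: mix.
- case: (ltngtP x y) => [|yx|/val_inj xey]; first exact: out.
    by move=> e; apply: (out y x yA xA) => //; rewrite edge_sym.
  by move: xy; rewrite xey edge_irrefl.
Qed.

Lemma full_coloring_range x : ~ stuck -> 0 < full_coloring x <= q.
Proof.
move=> nst; rewrite /full_coloring; case: ifPn => xA; first by case: pre => ->.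
by have [] := choice_free nst xA.
Qed.

End Choice.
End Extend.

(** * Correctness and cost of the extension passes *)

Section ExtendRuns.
Variables (n : nat) (adj : 'I_n -> seq 'I_n) (lab : seq nat).
Implicit Types (x y z w : 'I_n) (s : state).

Local Notation label := (@label n lab).
Local Notation core := (core n lab).
Local Notation degsum := (\sum_x size (adj x)).

Lemma runs_extremal_colors s :
  loaded adj lab s -> reg s 4 = 1 ->
  runs extremal_colors s (20 * (n * (reg s 3 + 1) + degsum) + 10 * n + 2)
    (fun s' => (forall x, x \notin core ->
        extremes (free adj (arr s 4) x) (reg s 3) (arr s' 6 x) (arr s' 7 x)) /\
      (reg s' 4 = 0 <-> exists2 x, x \notin core & arr s' 6 x = 0)).
Proof.
move=> ld s4; have [ld0 _ _ _ _] := ld.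
set q := reg s 3; set col := arr s 4.
pose I k s' := (forall x, x \notin core -> x < k ->
     extremes (free adj col x) q (arr s' 6 x) (arr s' 7 x)) /\
  (reg s' 4 = 0 <-> exists x, [/\ x \notin core, x < k & arr s' 6 x = 0]).
apply: (@runs_weaken _ _ (\sum_(x < n) (1 + (20 * (q + size (adj x) + 1) + 5) + 2) + 2) _ (I n)).
- rewrite (eq_bigr (fun x => 0 * 0 + size (adj x) * 20 + (20 * (q + 1) + 8))) => [|x _].
    by rewrite sum_affine card_ord; move: (\sum_x _) => d; clear; lia.
  by move: (size _) => d; clear; lia.
- move=> s' [ext st]; split=> [x xA|]; first exact: ext.
  by split=> [/st[x [xA _ x0]]|[x xA x0]]; [exists x | apply/st; exists x].
apply: runs_for_vertices => //.
  by split=> //; split=> [|[x []]//]; rewrite /= /upd /= s4.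
move=> x s1 s15 f1 [ext st].
have ld1 : loaded adj lab s1 := loaded_frame f1 isT isT ld.
have [_ _ ld12 _ lda] := ld1.
apply: (runs_seq (Q := eq (set_reg s1 15 (label x)))).
  by apply: (@runs_loopfree (Read 15 2 5)) => //=; rewrite s15 lda.
have x_lt (y : 'I_n) : (y < x.+1) = (y == x :> nat) || (y < x) by rewrite ltnS leq_eqVlt.
move=> _ <-; have [xA|nxA] := boolP (x \in core).
  apply: (@runs_leq _ _ 2); first by rewrite !addnS.
  apply: runs_if => /= [|_]; first by rewrite /upd /= ld12 ltnNge -ltnS -in_core xA.
  apply: (@runs_loopfree Skip) => //; split=> /=.
    move=> y yA; rewrite x_lt => /orP[/eqP/val_inj yx|]; last exact: ext.
    by rewrite yx xA in yA.
  rewrite /upd /= st; split=> -[y [yA yx y0]]; exists y; split=> //; first exact: leqW.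
  by move: yx; rewrite x_lt => /orP[/eqP/val_inj yx|//]; rewrite yx xA in yA.
set s2 := set_reg s1 15 _; have ld2 : loaded adj lab s2 := loaded_frame f1 isT isT ld.
rewrite addnS; apply: runs_if => /= [_|]; last first.
  by rewrite /upd /= ld12 -leqNgt -ltnS -in_core (negPf nxA).
have s23 : reg s2 3 = q by rewrite -[reg s2 3]/(reg s1 3) f1.1.
have s24 : arr s2 4 = col by rewrite -[arr s2 4]/(arr s1 4) f1.2.
have sp := runs_frame (runs_free_colors ld2 (s15 : reg s2 5 = x)).
rewrite s23 s24 in sp; apply: runs_seq sp _ => s3 [ext3 f3].
apply: (@runs_loopfree (Seq _ (Seq _ _))) => //.
have s35 : reg s3 5 = x by rewrite f3.1.
have s31 : reg s3 1 = 0 by have [_ -> _ _ _] := loaded_frame f3 isT isT ld2.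
have s34 : reg s3 4 = reg s1 4 by rewrite f3.1.
have s36 : arr s3 6 = arr s1 6 by rewrite f3.2.
have s37 : arr s3 7 = arr s1 7 by rewrite f3.2.
have [e|e] := eqVneq (reg s3 11) 0; split;
  rewrite /= /upd /= s31 ?e ?(negPf e) /= /upd /= ?s34 s35 s36 ?s37.
- move=> y yA; rewrite x_lt; case: eqP => [/val_inj->|_ /(ext _ yA)//].
  by move: ext3; rewrite e.
- by split=> // _; exists x; rewrite eqxx.
- move=> y yA; rewrite x_lt; case: eqP => [/val_inj->|_ /(ext _ yA)//].
  by [].
- rewrite st; split=> -[y [yA yx y0]]; exists y; split=> //; first exact: leqW.
  + by rewrite (ltn_eqF yx).
  + by move: yx y0; rewrite x_lt; case: eqP => // _ _ /eqP; rewrite (negPf e).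
  + by move: y0; case: eqP => // _ /eqP; rewrite (negPf e).
Qed.

Lemma runs_find_mate s x :
  loaded adj lab s -> reg s 5 = x ->
  runs find_mate s (6 * size (adj x) + 5) (fun s' => reg s' 14 = mate adj lab x).
Proof.
move=> ld s5; rewrite addnS -add1n.
have f0 : frame [:: 14] [::] s (set_reg s 14 x).
  by split=> // r; rewrite inE => /negPf r14; rewrite /= /upd r14.
apply: (runs_seq (Q := eq (set_reg s 14 x))).
  by apply: (@runs_loopfree (Move 14 5)) => //=; rewrite s5.
move=> _ <-.
have ld1 : loaded adj lab (set_reg s 14 x) := loaded_frame f0 isT isT ld.
apply: (runs_nbrs (I := fun l s' => reg s' 14 = mate_from lab x l) (c := 3) (x := x) _ _ ld1) => //.
  by move=> l s1 s2 [fr _] <-; rewrite fr.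
move=> l y s2 _ f2 s29 s214; apply: (@runs_loopfree (Seq _ _)) => //=.
have [_ _ _ ld16 lda] := loaded_frame f2 isT isT ld1.
rewrite /upd /= lda // s29 ld16 mate_from_rcons -/(label y).
by case: (label y == 3) => //=; rewrite /upd /= s29.
Qed.

Lemma runs_color_all s :
  let lo := arr s 6 in let hi := arr s 7 in
  loaded adj lab s ->
  runs color_all s (6 * degsum + 20 * n + 2)
    (fun s' => (forall x, arr s' 3 x = (full_coloring adj lab (arr s 4) lo hi x).-1) /\
      (reg s' 4 = 0 <-> reg s 4 = 0 \/ exists2 x, x \notin core & clash adj lab lo hi x)).
Proof.
move=> lo hi ld; have [ld0 _ _ _ _] := ld; set col := arr s 4.
pose I k s' := (forall x, x < k -> arr s' 3 x = (full_coloring adj lab col lo hi x).-1) /\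
  (reg s' 4 = 0 <-> reg s 4 = 0 \/ exists x, [/\ x \notin core, x < k & clash adj lab lo hi x]).
apply: (@runs_weaken _ _ (\sum_(x < n) (1 + (6 * size (adj x) + 5 + 11).+1 + 2) + 2) _ (I n)).
- rewrite (eq_bigr (fun x => 0 * 0 + size (adj x) * 6 + 20)) => [|x _].
    by rewrite sum_affine card_ord; move: (\sum_x _) => d; clear; lia.
  by move: (size _) => d; clear; lia.
- move=> s' [ext st]; split=> [x|]; first exact: ext.
  rewrite st; split=> -[|[x]]; try by left.
    by case=> xA _ cx; right; exists x.
  by move=> xA cx; right; exists x.
apply: runs_for_vertices => //.
  by split=> //; split; [left | case=> // -[x []]].
move=> x s1 s15 f1 [ext st].
have ld1 : loaded adj lab s1 := loaded_frame f1 isT isT ld.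
have [_ _ ld12 _ lda] := ld1.
have x_lt (y : 'I_n) : (y < x.+1) = (y == x :> nat) || (y < x).
  by rewrite ltnS leq_eqVlt.
apply: (runs_seq (Q := eq (set_reg s1 15 (label x)))).
  by apply: (@runs_loopfree (Read 15 2 5)) => //=; rewrite s15 lda.
move=> _ <-; set s2 := set_reg s1 15 _.
have ld2 : loaded adj lab s2 := loaded_frame f1 isT isT ld.
have s1col : arr s1 4 = col by rewrite f1.2.
apply: runs_if => /=; rewrite /upd /= ld12 ltnNge -ltnS -in_core.
  move=> nxA; apply: runs_seq (runs_frame (runs_find_mate ld2 s15)) _ => s3 [].
  set w := mate adj lab x => s3w f3.
  have lo3 : arr s3 6 = lo by rewrite f3.2 // f1.2.
  have hi3 : arr s3 7 = hi by rewrite f3.2 // f1.2.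
  have s33 : arr s3 3 = arr s1 3 by rewrite f3.2.
  have s35 : reg s3 5 = x by rewrite f3.1.
  have s34 : reg s3 4 = reg s1 4 by rewrite f3.1.
  (* The invariant depends only on the color written and on the flag, so all paths through
     [choose_color] reduce to these two equations. *)
  have fin s' : arr s' 3 = upd (arr s1 3) x (choice adj lab lo hi x).-1 ->
      reg s' 4 = (if clash adj lab lo hi x then 0 else reg s1 4) ->
      I x.+1 (set_reg s' 5 x.+1).
    move=> arr3 reg4; split=> /=.
      move=> y; rewrite x_lt arr3 /upd; case: eqP => [/val_inj-> _|_ /ext //].
      by rewrite /full_coloring (negPf nxA).
    rewrite /upd /= reg4; have [cx|ncx] := boolP (clash adj lab lo hi x).
      by split=> // _; right; exists x; rewrite ltnSn.
    rewrite st; split=> -[->|[y [yA yx cy]]]; try by left.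
      by right; exists y; split=> //; apply: leqW.
    right; exists y; split=> //; move: yx; rewrite x_lt => /orP[/eqP/val_inj yx|//].
    by rewrite -yx cy in ncx.
  apply: (@runs_loopfree choose_color) => //; apply: fin.
    rewrite /choice /= /upd /= s3w lo3 hi3 s35 -/w.
    by case: (x < w) => /=; rewrite /upd /=; case: eqP => //= _; rewrite /upd /=;
      try case: eqP => //= _; rewrite /upd /= s35 s33.
  rewrite /clash /= /upd /= s3w lo3 hi3 s35 -/w.
  by case: (x < w) => /=; rewrite /upd /=; case: eqP => //= _; rewrite /upd /= //;
    case: eqP => //= _; rewrite /upd /=.
rewrite negbK => xA; apply: (@runs_leq _ _ 3); first by rewrite !addnS.
apply: (@runs_loopfree copy_color) => //=; split=> /=.
  move=> y; rewrite x_lt /upd /= s15; case: eqP => [/val_inj-> _|_ /ext //].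
  by rewrite /full_coloring xA s1col.
rewrite /upd /= st; split=> -[->|[y [yA yx cy]]]; try by left.
  by right; exists y; split=> //; apply: leqW.
right; exists y; split=> //; move: yx; rewrite x_lt => /orP[/eqP/val_inj yx|//].
by rewrite yx xA in yA.
Qed.

End ExtendRuns.

(** * Colorings and the chromatic number *)

Section Chromatic.
Variables (n : nat) (G : sgraph 'I_n) (adj : 'I_n -> seq 'I_n) (lab : seq nat).
Implicit Types (x y z u v w : 'I_n) (s : state).

Local Notation label := (@label n lab).
Local Notation core := (core n lab).
Local Notation degsum := (\sum_x size (adj x)).

Hypothesis adjP : adjacency_lists G adj.
Hypothesis core_class : forall x y z, x \in core -> y \in core -> z \in core ->
  ~~ edge G x y -> ~~ edge G x z -> x != y -> x != z -> y = z.
Hypothesis core_split : forall x y, x \in core -> y \in core ->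
  x != y -> ~~ edge G x y -> label x = 1.
Hypothesis outer_edge : forall x y, x \notin core -> y \notin core -> edge G x y -> label x = 3.
Hypothesis matched : forall x y z, label x = 3 -> label y = 3 -> label z = 3 ->
  edge G x y -> edge G x z -> y = z.

Definition solves q s : Prop :=
  proper_coloring G (output_coloring s) /\ forall x, output_coloring s x < q.

(** Failure is conclusive for the given coloring of the core; the lower bounds on the chromatic
    number rest on this. *)
Lemma runs_extend s :
  loaded adj lab s -> precoloring G lab (arr s 4) (reg s 3) ->
  runs extend s (60 * (n * (reg s 3 + 1) + degsum + 1))
    (fun s' => if reg s' 4 == 0 then ~ extendable G lab (arr s 4) (reg s 3)
               else solves (reg s 3) s').
Proof.
move=> ld pre; set q := reg s 3.
apply: (@runs_leq _ _ (1 + ((20 * (n * (q + 1) + degsum) + 10 * n + 2) + (6 * degsum + 20 * n + 2)))).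
  by move: degsum => d; clear; lia.
apply: (runs_seq (Q := eq (set_reg s 4 1))); first exact: (@runs_loopfree (Const 4 1)).
move=> _ <-; set s1 := set_reg s 4 1.
have f1 : frame [:: 4] [::] s s1.
  by split=> // r; rewrite inE => /negPf r4; rewrite /= /upd r4.
have ld1 : loaded adj lab s1 := loaded_frame f1 isT isT ld.
apply: runs_seq (runs_frame (runs_extremal_colors ld1 (erefl _))) _ => s2 [[ext st] f2].
have ld2 : loaded adj lab s2 := loaded_frame f2 isT isT ld1.
apply: runs_weaken (runs_color_all ld2) => // s3 [col3 st3].
rewrite -[reg s1 3]/q -[arr s1 4]/(arr s 4) in ext.
rewrite f2.2 // -[arr s1 4]/(arr s 4) in col3.
have stP : reg s3 4 = 0 <-> stuck adj lab (arr s2 6) (arr s2 7).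
  rewrite st3 st; split=> [[[x xA x0]|[x xA cx]]|[x xA /orP[/eqP x0|cx]]].
  - by exists x; rewrite ?x0.
  - by exists x; rewrite ?cx ?orbT.
  - by left; exists x.
  - by right; exists x.
case: eqP => [/stP|/stP nst].
  by apply: (stuck_not_extendable adjP pre ext).
have rng x := full_coloring_range pre ext x nst.
have prop := full_coloring_proper adjP outer_edge matched pre ext nst.
split=> [x y xy|x]; rewrite /output_coloring !col3.
  move=> e; apply: (prop x y xy).
  have /andP[x0 _] := rng x; have /andP[y0 _] := rng y.
  by rewrite -(prednK x0) -(prednK y0) e.
by have /andP[x0 xq] := rng x; rewrite (leq_trans _ xq) // prednK.
Qed.

Definition colors_within q (c : 'I_n -> nat) : Prop :=
  proper_coloring G c /\ forall x, 0 < c x <= q.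

(* Renaming colors by successive transpositions, one vertex at a time. *)
Lemma extendable_kernel q (c : 'I_n -> nat) (b : nat -> nat) :
  colors_within q c -> (forall x, x \in core -> 0 < b x <= q) ->
  (forall x y, x \in core -> y \in core -> (c x == c y) = (b x == b y)) ->
  extendable G lab b q.
Proof.
move=> [prop rng] brng ker.
suff gen (l : seq 'I_n) : {subset l <= core} ->
    exists c' : 'I_n -> nat, [/\ forall x, 0 < c' x <= q,
      forall x y, (c' x == c' y) = (c x == c y) & forall x, x \in l -> c' x = b x].
  have [|c' [rng' ker' eqb]] := gen (enum core); first by move=> x; rewrite mem_enum.
  exists c'; split=> // [x y xy /eqP|x xA]; last by rewrite eqb // mem_enum.
  by rewrite ker' => /eqP; apply: prop.
elim: l => [_|v l IHl lA]; first by exists c.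
have [|c' [rng' ker' eqb]] := IHl; first by move=> x xl; rewrite lA // inE xl orbT.
have vA : v \in core by rewrite lA ?mem_head.
(* The transposition of [c' v] and [b v]. A vertex [x] already recolored to [b x] is not spoiled:
   since the kernels agree, it can be hit only if [b x = b v], and then its color is [c' v] as
   well. *)
pose sw i := if i == c' v then b v else if i == b v then c' v else i.
have swI : injective sw.
  by move=> i j; rewrite /sw; clear; repeat case: eqP => ?; lia.
exists (sw \o c'); split=> [x|x y|x] /=.
- by rewrite /sw; case: ifP => _; [exact: brng | case: ifP].
- by rewrite (inj_eq swI) ker'.
rewrite inE => /orP[/eqP->|xl]; first by rewrite /sw eqxx.
have xA : x \in core by rewrite lA // inE xl orbT.
have kxv : (c' x == c' v) = (b x == b v) by rewrite ker' ker.
rewrite /sw eqb //= in kxv *; case: eqP => [e|ne].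
  by move: kxv; rewrite e eqxx => /esym/eqP.
by case: eqP => // e; rewrite e eqxx in kxv; move/eqP: kxv ne => <-; rewrite e.
Qed.

(** * Colorings compared with the first-fit coloring of the core *)

Section Base.
Variables (b : nat -> nat) (q : nat).
Hypothesis base : multipartite_coloring G lab n b q.

Lemma base_range x : x \in core -> 0 < b x <= q.
Proof. by case: base => rng _ _ _ xA; apply: rng. Qed.

Lemma base_kernel x y : x \in core -> y \in core -> (b x == b y) = ~~ edge G x y.
Proof. by case: base => _ _ ker _ xA yA; apply: ker. Qed.

Lemma base_precoloring k : q <= k -> precoloring G lab b k.
Proof.
move=> qk; split=> [x xA|x xA|x y xA yA xy].
- by have /andP[-> /leq_trans->] := base_range xA.
- by case: base => _ zer _ _; apply: zer; rewrite (negPf xA).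
- by apply/eqP; rewrite base_kernel // xy.
Qed.

Lemma split_precoloring v : v \in core -> precoloring G lab (upd b v q.+1) q.+1.
Proof.
move=> vA; have updE (y : 'I_n) : upd b v q.+1 y = if y == v then q.+1 else b y by [].
have [rng zer prop] := base_precoloring (leqnSn q).
split=> [x xA|x xA|x y xA yA xy]; rewrite !updE.
- by case: eqP => _; [rewrite leqnn | apply: rng].
- by case: eqP xA => [->|_ xA]; [rewrite vA | apply: zer].
- have [/andP[_ bx] /andP[_ by_]] := (base_range xA, base_range yA).
  case: eqP xy => [->|_]; case: eqP => [->|_] xy.
  + by rewrite edge_irrefl in xy.
  + by move=> e; rewrite -e ltnn in by_.
  + by move=> e; rewrite e ltnn in bx.
  + exact: prop.
Qed.

(** The map [b] numbers the parts from 1 to [q], and [f j] is the color under [c] of one chosen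
    vertex of part [j]. *)
Definition representative (c : 'I_n -> nat) (f : nat -> nat) : Prop :=
  forall j, 0 < j <= q -> exists x, [/\ x \in core, b x = j & c x = f j].

Lemma ex_representative c : exists f, representative c f.
Proof.
exists (fun j => if [pick x in core | b x == j] is Some x then c x else 0) => j jq.
case: pickP => [x /andP[xA /eqP bx]|nx]; first by exists x.
by case: base => _ _ _ /(_ j jq)[x [xA _ bx]]; have := nx x; rewrite xA bx eqxx.
Qed.

Lemma upd_representative c f v : v \in core ->
  representative c f -> representative c (upd f (b v) (c v)).
Proof.
move=> vA rep j /rep[x [xA bx cx]]; rewrite /upd; case: eqP => [->|_]; first by exists v.
by exists x.
Qed.

(* One color per part, plus the vertices of [e], whose colors are extra. *)
Lemma count_colors k c f (e : seq 'I_n) :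
  colors_within k c -> representative c f -> {subset e <= core} ->
  uniq [seq c x | x <- e] -> {in e, forall x, c x <> f (b x)} -> q + size e <= k.
Proof.
move=> [prop rng] rep eA ue ef.
have same x y : x \in core -> y \in core -> c x = c y -> b x = b y.
  move=> xA yA cxy; apply/eqP; rewrite base_kernel //.
  by apply/negP => /prop.
(* The list of all [f j] followed by the colors of [e] is duplicate-free, since distinct parts are
   completely adjacent, and lies between 1 and [k]. *)
rewrite -(size_iota 1 q) -(size_map f) -(size_map c e) -size_cat -[X in _ <= X](size_iota 1).
apply: uniq_leq_size => [|j]; last first.
  rewrite mem_cat mem_iota add1n ltnS => /orP[] /mapP[x].
    by rewrite mem_iota add1n ltnS => /rep[y [_ _ <-]] ->.
  by move=> _ ->.
rewrite cat_uniq ue andbT; apply/andP; split.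
  rewrite map_inj_in_uniq ?iota_uniq // => i j.
  rewrite !mem_iota !add1n !ltnS => /rep[x [xA <- <-]] /rep[y [yA <- <-]].
  exact: same.
apply/hasPn => _ /mapP[x xe ->]; apply/mapP => -[j].
rewrite mem_iota add1n ltnS => jq cx; have [y [yA byj cy]] := rep j jq.
have bxy : b x = b y by apply: same => //; [apply: eA | rewrite cx cy].
by apply: (ef x xe); rewrite cx bxy byj.
Qed.

Lemma leq_colors k c : colors_within k c -> q <= k.
Proof.
move=> cw; have [f rep] := ex_representative c.
by rewrite -(addn0 q); apply: (count_colors (e := [::]) cw rep).
Qed.

(** With only [q] colors no part is split: two colors on one part, with [x] as its representative
    and [y] as the extra vertex, would give [q + 1] colors. *)
Lemma extendable_base c : colors_within q c -> extendable G lab b q.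
Proof.
move=> cw; apply: (extendable_kernel cw) => [x|x y xA yA]; first exact: base_range.
rewrite base_kernel //; have [prop rng] := cw.
apply/eqP/idP => [cxy|nxy]; first by apply/negP => /prop.
apply/eqP/contraT => /eqP ncxy.
have [f rep] := ex_representative c.
have := count_colors (e := [:: y]) cw (upd_representative xA rep) _ _ _.
rewrite addn1 ltnn; apply=> // z; rewrite inE => /eqP-> //.
rewrite /upd; have -> : b y = b x by apply/eqP; rewrite eq_sym base_kernel.
by rewrite eqxx => /esym.
Qed.

(** If [c] splits no part, it has the kernel of [b]. Otherwise it splits a part consisting of [v]
    and [u], and has the kernel of [b] with [v] recolored, as a second split part would force
    [q + 2] colors. *)
Lemma extendable_split c : colors_within q.+1 c ->
  extendable G lab b q.+1 \/
  exists v, label v = 1 /\ extendable G lab (upd b v q.+1) q.+1.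
Proof.
move=> cw; have [prop rng] := cw.
have same x y : x \in core -> y \in core -> c x = c y -> b x = b y.
  by move=> xA yA cxy; apply/eqP; rewrite base_kernel //; apply/negP => /prop.
have [/existsP[v /existsP[u /and5P[vA uA nvu nev /eqP ncvu]]]|nsp] := boolP
  [exists v, exists u, [&& v \in core, u \in core, v != u, ~~ edge G v u & c v != c u]].
  right; exists v; split; first exact: (core_split vA uA nvu nev).
  have bvu : b v = b u by apply/eqP; rewrite base_kernel.
  have part_v y : y \in core -> y != v -> b y = b v -> y = u.
    move=> yA nyv byv; apply/esym/(core_class vA uA yA) => //; last by rewrite eq_sym.
    by rewrite -base_kernel // byv.
  have [srng _ _] := split_precoloring vA.
  apply: (extendable_kernel cw srng) => x y xA yA.
  have updE (z : 'I_n) : upd b v q.+1 z = if z == v then q.+1 else b z by [].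
  have split_v z : z \in core -> z != v -> (c v == c z) = (q.+1 == b z).
    move=> zA nzv; have /andP[_ bz] := base_range zA.
    rewrite (gtn_eqF (bz : _ < q.+1)); apply/eqP => cvz.
    by apply: ncvu; rewrite cvz -(part_v z) //; apply/esym/same.
  rewrite !updE; have [->|nxv] := eqVneq x v; have [->|nyv] := eqVneq y v.
  - by rewrite !eqxx.
  - exact: split_v.
  - by rewrite eq_sym split_v // eq_sym.
  apply/eqP/eqP => [|bxy]; first exact: same.
  apply/eqP/contraT => /eqP ncxy.
  have nbxv : b x <> b v.
    by move=> bxv; apply: ncxy; rewrite (part_v x) // (part_v y) // -bxy.
  have [f rep] := ex_representative c.
  (* The parts are represented by [v] and [x], so that [u] and [y] contribute two extra colors. *)
  have rep' := upd_representative xA (upd_representative vA rep).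
  have := count_colors (e := [:: u; y]) cw rep' _ _ _.
  rewrite addn2 ltnn; apply.
  - by move=> z; rewrite mem_seq2 => /orP[] /eqP->.
  - rewrite /= inE andbT; apply/eqP => /(same _ _ uA yA) buy.
    by apply: nbxv; rewrite bxy -buy.
  - move=> z; rewrite mem_seq2 => /orP[] /eqP->; rewrite /upd.
      by rewrite -bvu eqxx; case: eqP => [/esym//|_ /esym].
    by rewrite -bxy eqxx => /esym.
left; apply: (extendable_kernel cw) => [x xA|x y xA yA].
  by have /andP[-> /leqW] := base_range xA.
apply/eqP/eqP => [|/eqP nxy]; first exact: same.
rewrite base_kernel // in nxy.
apply/eqP/contraT => ncxy; case/existsP: nsp; exists x; apply/existsP; exists y.
by rewrite xA yA nxy ncxy !andbT; apply: contra ncxy => /eqP->.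
Qed.

(** Edges outside the core join mates only; the smaller end takes one new color and the larger the
    other. *)
Lemma extendable_two_more : extendable G lab b q.+2.
Proof.
exists (fun x => if x \in core then b x else if x < mate adj lab x then q.+2 else q.+1).
split=> [x|x y xy|x ->//].
  case: ifP => [xA|_]; last by case: ifP => _; rewrite /= ?leqnn ?leqnSn.
  by have /andP[-> bx] := base_range xA; rewrite !leqW.
have big i : i <= q -> i <> q.+1 /\ i <> q.+2 by clear; lia.
have [_ _ prop] := base_precoloring (leqnn q).
have [xA|xA] := boolP (x \in core); have [yA|yA] := boolP (y \in core); first exact: prop.
- have /andP[_ bx] := base_range xA; have [n1 n2] := big _ bx; by case: ifP.
- have /andP[_ by_] := base_range yA; have [n1 n2] := big _ by_; by case: ifP => _ /esym.
rewrite (mate_edge adjP outer_edge matched xA yA xy).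
rewrite (mate_edge adjP outer_edge matched yA xA) 1?edge_sym //.
have nxy : x != y by apply: contraTneq xy => ->; rewrite edge_irrefl.
by case: ltngtP nxy => [_ _|_ _|/val_inj->]; rewrite ?eqxx // => /eqP;
  rewrite ?(ltn_eqF (leqnn _)) ?(gtn_eqF (leqnn _)).
Qed.
End Base.
End Chromatic.

(** * The algorithm *)

(** Register 2 holds 1, the label of [Mbar], and register 3 the new color. Register 21 saves the old
    color for restoring; after a success the remaining rounds do nothing. *)
Definition split_search : program :=
  for_ 20 0 (If (TEq 4 1) (Seq (Read 15 2 20) (If (TEq 15 2)
    (Seq (Seq (Read 21 4 20) (Write 4 20 3)) (Seq extend (Write 4 20 21)))
    Skip)) Skip).

Definition optimal_coloring_program : program :=
  Seq (Seq (Const 2 1) (Const 16 3)) (Seq color_core (Seq extend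
    (If (TEq 4 1)
      (Seq (Succ 3 3) (Seq extend (Seq split_search
        (If (TEq 4 1) (Seq (Succ 3 3) extend) Skip))))
      Skip))).

Section Main.
Variables (n : nat) (G : sgraph 'I_n) (adj : 'I_n -> seq 'I_n) (lab : seq nat).
Implicit Types (x y z u v w : 'I_n) (s : state).

Local Notation label := (@label n lab).
Local Notation core := (core n lab).
Local Notation degsum := (\sum_x size (adj x)).

Hypothesis adjP : adjacency_lists G adj.
Hypothesis core_class : forall x y z, x \in core -> y \in core -> z \in core ->
  ~~ edge G x y -> ~~ edge G x z -> x != y -> x != z -> y = z.
Hypothesis core_split : forall x y, x \in core -> y \in core ->
  x != y -> ~~ edge G x y -> label x = 1.
Hypothesis outer_edge : forall x y, x \notin core -> y \notin core -> edge G x y -> label x = 3.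
Hypothesis matched : forall x y z, label x = 3 -> label y = 3 -> label z = 3 ->
  edge G x y -> edge G x z -> y = z.

(** Overwriting and restoring a cell gives back the array only up to pointwise equality. *)
Lemma precoloring_ext (b b' : nat -> nat) q :
  b =1 b' -> precoloring G lab b q -> precoloring G lab b' q.
Proof.
move=> bb [rng zer prop]; split=> [x xA|x xA|x y xA yA xy]; rewrite -!bb.
- exact: rng.
- exact: zer.
- exact: prop.
Qed.

Lemma extendable_ext (b b' : nat -> nat) q :
  b =1 b' -> extendable G lab b q -> extendable G lab b' q.
Proof.
by move=> bb [c [rng prop eqb]]; exists c; split=> // x xA; rewrite -bb eqb.
Qed.

(** The search also runs after a success, and then keeps the solution. Calls of [extend] are charged
    to vertices of the core, whence the factor [#|core|] instead of [n]. *)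
Lemma runs_split_search s b q :
  loaded adj lab s -> multipartite_coloring G lab n b q ->
  arr s 4 =1 b -> reg s 3 = q.+1 -> (reg s 4 == 0 \/ solves G q.+1 s) ->
  runs split_search s
    (#|core| * (60 * (n * (q.+1 + 1) + degsum + 1) + 3) + 6 * n + 2)
    (fun s' => arr s' 4 =1 b /\
       if reg s' 4 == 0
       then reg s 4 = 0 /\ forall v, label v = 1 -> ~ extendable G lab (upd b v q.+1) q.+1
       else solves G q.+1 s').
Proof.
move=> ld base s4 s3 ok; have [ld0 ld1 _ _ _] := ld.
set E := 60 * _.
pose I k s' := arr s' 4 =1 b /\
  if reg s' 4 == 0
  then reg s 4 = 0 /\ forall v, v < k -> label v = 1 -> ~ extendable G lab (upd b v q.+1) q.+1
  else solves G q.+1 s'.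
apply: (@runs_weaken _ _ (\sum_(v < n) ((1 + (1 + ((v \in core) * (E + 3) + 1).+1)) + 2) + 2) _ (I n)).
- rewrite (eq_bigr (fun v => (v \in core) * (E + 3) + 0 * 0 + 6)) => [|v _].
    by rewrite sum_affine sum_mem card_ord; move: (E) #|core| => d a; clear; lia.
  by move: (_ * _) => d; clear; lia.
- move=> s' [b4]; case: ifP => _; last by split.
  by case=> s40 H; split=> //; split=> // v; apply: H.
apply: runs_for_vertices => //.
  split=> //=; rewrite /upd /=; case: eqP => // s40.
  by case: ok => // /eqP.
move=> v s1 s1v f1 [b4 st].
have ldv : loaded adj lab s1 := loaded_frame f1 isT isT ld.
have [_ ld11 ld12 _ lda] := ldv.
rewrite [1 + (1 + _)]add1n; apply: runs_if => /=; rewrite ld11 => s14; last first.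
  apply: (@runs_leq _ _ 1) => //; apply: (@runs_loopfree Skip) => //.
  by split=> //=; rewrite /upd /= in st *; rewrite (negPf s14) in st *.
rewrite s14 in st; case: st => s40 st.
have [rng zer prop] := base_precoloring base (leqnSn q).
apply: (runs_seq (Q := eq (set_reg s1 15 (label v)))).
  by apply: (@runs_loopfree (Read 15 2 20)) => //=; rewrite s1v lda.
have v_lt (y : 'I_n) : (y < v.+1) = (y == v :> nat) || (y < v).
  by rewrite ltnS leq_eqVlt.
move=> _ <-; apply: runs_if => /=; rewrite /upd /= ld12 => lv; last first.
  apply: (@runs_leq _ _ 1); first by rewrite leq_addl.
  apply: (@runs_loopfree Skip) => //; split=> //=; rewrite /upd /= s14; split=> // y.
  rewrite v_lt => /orP[/eqP/val_inj->|]; last exact: st.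
  by move=> l1; rewrite l1 in lv.
have vA : v \in core by rewrite in_core (eqP lv).
have s13 : reg s1 3 = q.+1 by rewrite f1.1.
rewrite vA mul1n; apply: (@runs_leq _ _ (2 + (E + 1))); first by move: (E) => d; clear; lia.
pose s2 := set_reg (set_reg s1 15 (label v)) 21 (arr s1 4 v).
pose t3 := set_arr s2 4 v q.+1.
apply: (runs_seq (Q := eq t3)).
  by apply: (@runs_loopfree (Seq _ _)) => //=; rewrite /upd /= s1v s13.
have f3 : frame [:: 15; 21] [:: 4] s1 t3.
  split=> r; rewrite !inE ?negb_or; first by case/andP=> /negPf r15 /negPf r21; rewrite /= /upd r15 r21.
  by move=> /negPf r4; rewrite /= /upd r4.
move=> _ <-; have ld3 : loaded adj lab t3 := loaded_frame f3 isT isT ldv.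
have s34 : arr t3 4 =1 upd b v q.+1 by move=> i; rewrite /= /upd /=; case: eqP.
have s33 : reg t3 3 = q.+1 by [].
have pre3 : precoloring G lab (arr t3 4) (reg t3 3).
  rewrite s33; apply: (precoloring_ext (b := upd b v q.+1)) => //.
  exact: (split_precoloring base vA).
have := runs_frame (runs_extend adjP outer_edge matched ld3 pre3).
rewrite s33 => ext; apply: runs_seq ext _ => s4' [st4 f4].
apply: (@runs_loopfree (Write 4 20 21)) => //; split=> /=.
  move=> i; rewrite /upd /=; have -> : reg s4' 20 = v by rewrite f4.1.
  have -> : reg s4' 21 = arr s1 4 v by rewrite f4.1.
  case: eqP => [->|/eqP iv]; first exact: b4.
  by rewrite f4.2 // s34 /upd (negPf iv).
rewrite /upd /=; case: ifP st4 => // _ nex; split=> // y.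
rewrite v_lt => /orP[/eqP/val_inj-> _|]; last exact: st.
by move=> ex; apply: nex; apply: extendable_ext ex => i; rewrite s34.
Qed.

Lemma colorable_within k : colorable G k -> exists c, colors_within G k c.
Proof.
move=> /existsP[f fP]; exists (fun x => (f x).+1); split=> [x y xy [e]|x]; last exact: (ltn_ord (f x)).
by have /forallP/(_ x)/forallP/(_ y)/implyP/(_ xy)/eqP := fP; apply; apply: val_inj.
Qed.

Lemma not_colorable_gt q k :
  (forall c, ~ colors_within G q c) -> colorable G k -> q < k.
Proof.
move=> nq /colorable_within[c [prop rng]]; rewrite ltnNge; apply/negP => kq.
by apply: (nq c); split=> // x; have /andP[-> /leq_trans->] := rng x.
Qed.

Lemma solves_optimal q s :
  solves G q s -> (forall k, colorable G k -> q <= k) ->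
  optimal_coloring G (output_coloring s).
Proof.
move=> [prop rng] qmin; split=> // x; apply: leq_trans (rng x) _.
by rewrite /chromatic_number; case: ex_minnP => k /qmin.
Qed.

Lemma runs_optimal_coloring s :
  reg s 0 = n -> reg s 1 = 0 -> reg s 3 = 0 ->
  (forall a, a < 3 -> arr s a =1 nth 0 (input_array adj lab a)) ->
  (forall i, arr s 4 i = 0) ->
  runs optimal_coloring_program s
    (2000 * ((#|core| + 1) * (n * (#|core| + 1) + degsum + 1)))
    (fun s' => optimal_coloring G (output_coloring s')).
Proof.
move=> s0 s1 s3 sa s4.
pose s' := set_reg (set_reg s 2 1) 16 3.
have ld' : loaded adj lab s' by split.
set a := #|core|; set D := degsum.
(* Budget of one call of [extend]: the number of colors is at most [q + 2 <= a + 2]. *)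
pose E := 60 * (n * (a + 3) + D + 1).
apply: (@runs_leq _ _ (2 + ((20 * (a * (a + 1) + D) + 12 * n + 2) + (E +
   (1 + (E + ((a * (E + 3) + 6 * n + 2) + (1 + E).+1))).+1)))).
  have an : a <= n by rewrite -[n in _ <= n]card_ord max_card.
  (* Every product is first bounded by a multiple of [X] or [a * X], so that the remaining goal is
     linear. *)
  set X := n * (a + 1) + D + 1.
  have EX : E <= 180 * X by rewrite /E /X; move: (a) (D) => i j; clear; lia.
  have aX : a * (a + 1) <= X by rewrite /X -addnA -[X in X <= _]addn0 leq_add // leq_mul2r an orbT.
  have aEX : a * E <= 180 * (a * X) by rewrite mulnCA leq_mul2l EX orbT.
  have nX : n + D + 1 <= X by rewrite /X !leq_add2r leq_pmulr // addn1.
  clearbody X E; move: (a) (D) an EX aX aEX nX => i j; clear; lia.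
apply: (runs_seq (Q := eq s')); first exact: (@runs_loopfree (Seq _ _)).
move=> _ <-.
apply: runs_seq (runs_frame (runs_color_core adjP core_class ld' _ _)) _ => //.
move=> {}s1 [base f1]; set q := reg s1 3 in base; set b := arr s1 4 in base.
have ld1 : loaded adj lab s1 := loaded_frame f1 isT isT ld'.
have qa : q <= a := leq_card_core base.
have EP k : k <= a + 2 -> 60 * (n * (k + 1) + D + 1) <= E.
  move=> ka; rewrite leq_mul // !leq_add2r leq_mul //.
  by rewrite -[3]/(2 + 1) addnA leq_add2r.
have minq k : colorable G k -> q <= k.
  by move=> /colorable_within[c]; apply: (leq_colors base).
apply: runs_seq.
  apply: (runs_leq (EP q _)); first by apply: leq_trans qa (leq_addr _ _).
  apply: runs_frame (runs_extend adjP outer_edge matched ld1 _).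
  exact: (base_precoloring base).
move=> s2 [st2 f2]; have ld2 : loaded adj lab s2 := loaded_frame f2 isT isT ld1.
have [_ ld21 _ _ _] := ld2.
apply: runs_if => /=; rewrite ld21 => s24; last first.
  apply: (@runs_leq _ _ 1) => //; apply: (@runs_loopfree Skip) => //=.
  by rewrite (negPf s24) in st2; apply: solves_optimal st2 minq.
rewrite s24 in st2.
have ltq k : colorable G k -> q < k.
  apply: not_colorable_gt => c cw; apply: st2.
  exact: (extendable_base base cw).
apply: (runs_seq (Q := eq (set_reg s2 3 q.+1))).
  by apply: (@runs_loopfree (Succ 3 3)) => //=; rewrite f2.1.
move=> _ <-; set s3' := set_reg s2 3 q.+1.
have f3 : frame [:: 3] [::] s2 s3'.
  by split=> // r; rewrite inE => /negPf r3; rewrite /= /upd r3.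
have ld3 : loaded adj lab s3' := loaded_frame f3 isT isT ld2.
have s34 : arr s3' 4 = b by rewrite -[arr s3' 4]/(arr s2 4) f2.2.
have Eq1 : 60 * (n * (q.+1 + 1) + D + 1) <= E by apply: EP; rewrite addn2 ltnS leqW.
have Eq2 : 60 * (n * (q.+2 + 1) + D + 1) <= E by apply: EP; rewrite addn2 !ltnS.
apply: runs_seq.
  apply: (runs_leq Eq1); apply: runs_frame (runs_extend adjP outer_edge matched ld3 _).
  by rewrite s34; apply: (base_precoloring base (leqnSn q)).
move=> s5 [st5 f5]; have ld5 : loaded adj lab s5 := loaded_frame f5 isT isT ld3.
rewrite s34 in st5.
have s54 : arr s5 4 = b by rewrite f5.2.
have s53 : reg s5 3 = q.+1 by rewrite f5.1.
apply: runs_seq.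
  apply: runs_leq (runs_frame (runs_split_search ld5 base _ s53 _)).
  - by rewrite !leq_add2r leq_mul // leq_add2r Eq1.
  - by rewrite s54.
  - by case: ifP st5 => [/eqP s50 _|_]; [left; apply/eqP | right].
move=> s6 [[s64 st6] f6]; have ld6 : loaded adj lab s6 := loaded_frame f6 isT isT ld5.
have [_ ld61 _ _ _] := ld6.
apply: runs_if => /=; rewrite ld61 => s60; last first.
  apply: (@runs_leq _ _ 1) => //; apply: (@runs_loopfree Skip) => //=.
  by rewrite (negPf s60) in st6; apply: solves_optimal st6 ltq.
rewrite s60 in st6; case: st6 => s50 st6; rewrite s50 in st5.
(* The base and all its splits have failed with [q + 1] colors, which exhausts the cases of
   [extendable_split]. *)
have ltSq k : colorable G k -> q.+1 < k.
  apply: not_colorable_gt => c cw.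
  by case: (extendable_split core_class core_split base cw) => [|[v [/st6]]].
rewrite -add1n; apply: (runs_seq (Q := eq (set_reg s6 3 q.+2))).
  by apply: (@runs_loopfree (Succ 3 3)) => //=; rewrite f6.1 // s53.
move=> _ <-; set s7 := set_reg s6 3 q.+2.
have f7 : frame [:: 3] [::] s6 s7.
  by split=> // r; rewrite inE => /negPf r3; rewrite /= /upd r3.
have ld7 : loaded adj lab s7 := loaded_frame f7 isT isT ld6.
have s64' : b =1 arr s7 4 by move=> i; rewrite -[arr s7 4]/(arr s6 4) s64.
have pre7 : precoloring G lab (arr s7 4) q.+2.
  by apply: precoloring_ext s64' _; apply: (base_precoloring base); apply/leqW/leqW.
apply: (runs_leq Eq2).
apply: runs_weaken (runs_extend adjP outer_edge matched ld7 pre7) => // s8.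
(* Failure is impossible here, since two additional colors always suffice. *)
case: ifP => [_ []|_ st8]; last exact: solves_optimal st8 ltSq.
apply: extendable_ext s64' _.
exact: (extendable_two_more adjP outer_edge matched base).
Qed.
End Main.

(** * Maya-Tupi partitions and the size of the core *)

Section Labels.
Variables (n : nat) (G : sgraph 'I_n) (K Mbar S M : {set 'I_n}).
Hypothesis mt : MT_partition G K Mbar S M.
Implicit Types x y z : 'I_n.

Local Notation lab := (labels K Mbar S M).

Lemma labelE x :
  label lab x = (x \in Mbar) * 1 + (x \in S) * 2 + (x \in M) * 3.
Proof. by rewrite /label /labels (nth_map x) ?size_enum_ord // nth_ord_enum. Qed.

Lemma label_core x : (x \in core n lab) = (x \in K) || (x \in Mbar).
Proof.
have [/(_ x) + _] := mt; rewrite in_core labelE.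
by case: (x \in K); case: (x \in Mbar); case: (x \in S); case: (x \in M).
Qed.

Lemma label_eq1 x : (label lab x == 1) = (x \in Mbar).
Proof.
have [/(_ x) + _] := mt; rewrite labelE.
by case: (x \in K); case: (x \in Mbar); case: (x \in S); case: (x \in M).
Qed.

Lemma label_eq3 x : (label lab x == 3) = (x \in M).
Proof.
have [/(_ x) + _] := mt; rewrite labelE.
by case: (x \in K); case: (x \in Mbar); case: (x \in S); case: (x \in M).
Qed.

Lemma label_outer x : (x \notin core n lab) = (x \in S) || (x \in M).
Proof.
have [/(_ x) + _] := mt; rewrite in_core labelE.
by case: (x \in K); case: (x \in Mbar); case: (x \in S); case: (x \in M).
Qed.

Lemma matching_unique (H : sgraph 'I_n) (A : {set 'I_n}) x y z :
  induces_matching H A -> x \in A -> y \in A -> z \in A ->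
  edge H x y -> edge H x z -> y = z.
Proof.
move=> hA xA yA zA xy xz; have /eqP/cards1P[w ew] := hA x xA.
have yw : y \in [set w] by rewrite -ew inE yA.
have zw : z \in [set w] by rewrite -ew inE zA.
by rewrite (set1P yw) (set1P zw).
Qed.

Lemma core_nonadjacent x y : x \in core n lab -> y \in core n lab ->
  x != y -> ~~ edge G x y -> (x \in Mbar) && (y \in Mbar).
Proof.
have [_ [_ [cK _ KM]]] := mt; rewrite !label_core => /orP[xK|xM] /orP[yK|yM] nxy nexy.
- by rewrite cK in nexy.
- by rewrite KM in nexy.
- by rewrite edge_sym KM in nexy.
- by rewrite xM.
Qed.

Lemma mt_core_split x y : x \in core n lab -> y \in core n lab ->
  x != y -> ~~ edge G x y -> label lab x = 1.
Proof.
move=> xA yA nxy nexy; apply/eqP; rewrite label_eq1.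
by have /andP[] := core_nonadjacent xA yA nxy nexy.
Qed.

(** Both [y] and [z] are the partner of [x] in the matching that [Mbar] induces in the
    complement. *)
Lemma mt_core_class x y z :
  x \in core n lab -> y \in core n lab -> z \in core n lab ->
  ~~ edge G x y -> ~~ edge G x z -> x != y -> x != z -> y = z.
Proof.
move=> xA yA zA nexy nexz nxy nxz.
have /andP[xM yM] := core_nonadjacent xA yA nxy nexy.
have /andP[_ zM] := core_nonadjacent xA zA nxz nexz.
have [_ [[_ _ hM] _]] := mt.
by apply: (matching_unique hM xM yM zM); rewrite /= /compl_edge ?nxy ?nxz.
Qed.

Lemma mt_outer_edge x y : x \notin core n lab -> y \notin core n lab ->
  edge G x y -> label lab x = 3.
Proof.
have [_ [[iS _ _] [_ SM _]]] := mt; rewrite !label_outer => xA yA xy.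
apply/eqP; rewrite label_eq3; case/orP: xA => // xS; case/orP: yA => [yS|yM].
  by have := iS x y xS yS; rewrite xy.
by have := SM x y xS yM; rewrite xy.
Qed.

Lemma mt_matched x y z : label lab x = 3 -> label lab y = 3 -> label lab z = 3 ->
  edge G x y -> edge G x z -> y = z.
Proof.
have [_ [[_ hM _] _]] := mt; do 3!(move=> /eqP; rewrite label_eq3 => ?).
exact: matching_unique hM _ _ _.
Qed.

End Labels.

(** * Edge counts and the time budget *)

Section Counting.
Variables (n : nat) (G : sgraph 'I_n) (adj : 'I_n -> seq 'I_n).
Hypothesis adjP : adjacency_lists G adj.

Lemma size_adj x : size (adj x) = #|edge G x|.
Proof. by have [/card_uniqP <- e] := adjP x; apply: eq_card. Qed.

Lemma sum_degrees : \sum_x size (adj x) <= 2 * #|edges G|.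
Proof.
pose E := [set p : 'I_n * 'I_n | edge G p.1 p.2].
have -> : \sum_x size (adj x) = #|E|.
  rewrite -sum1_card (eq_bigr (fun x => \sum_(y | edge G x y) 1)) => [|x _].
    by rewrite pair_big_dep /=; apply: eq_bigl => p; rewrite inE.
  by rewrite size_adj sum1_card.
have -> : edges G = [set [set p.1; p.2] | p in E].
  by apply/setP=> A; apply/imsetP/imsetP=> -[p pE ->]; exists p; rewrite ?inE // in pE *.
rewrite -[#|E|]sum1_card (partition_big_imset (fun p : 'I_n * 'I_n => [set p.1; p.2])) /=.
rewrite mulnC -sum_nat_const; apply: leq_sum => A /imsetP[[a b] _ ->] /=.
(* At most two ordered pairs give the same edge. *)
rewrite sum1dep_card; apply: (@leq_trans #|[set (a, b); (b, a)]|); last by rewrite cards2; case: eqP.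
apply/subset_leq_card/subsetP => -[c d]; rewrite !inE /= => /andP[_ /eqP e].
have ca : c \in [set a; b] by rewrite -e set21.
have da : d \in [set a; b] by rewrite -e set22.
have ac : a \in [set c; d] by rewrite e set21.
have bc : b \in [set c; d] by rewrite e set22.
move: ca da ac bc; rewrite !inE !xpair_eqE ![a == _]eq_sym ![b == _]eq_sym.
by case: (c == a); case: (c == b); case: (d == a); case: (d == b).
Qed.

(** A vertex of [A] is adjacent to all of [A] except itself and at most one other vertex. *)
Lemma sum_core_degrees (A : {set 'I_n}) :
  (forall x y z, x \in A -> y \in A -> z \in A ->
     ~~ edge G x y -> ~~ edge G x z -> x != y -> x != z -> y = z) ->
  #|A| * (#|A| - 2) <= \sum_x size (adj x).
Proof.
move=> cls; rewrite -sum_nat_const [leqRHS](bigID (mem A)) /=.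
apply: leq_trans (leq_addr _ _); apply: leq_sum => x xA.
pose N := [set y in A | (y != x) && ~~ edge G x y].
have N1 : #|N| <= 1.
  apply/card_le1_eqP => y z; rewrite !inE => /and3P[yA nyx xy] /and3P[zA nzx xz].
  by apply: (cls x z y) => //; rewrite eq_sym.
have sub : A \subset [set y | edge G x y] :|: (x |: N).
  apply/subsetP => y yA; rewrite !inE yA /=.
  by case: (edge G x y) => //=; case: eqP.
rewrite size_adj leq_subLR addnC; apply: leq_trans (subset_leq_card sub) _.
apply: leq_trans (leq_card_setU _ _) _; rewrite cardsE leq_add2l cardsU1.
by rewrite -[2]/(1 + 1) leq_add // leq_b1.
Qed.

End Counting.

Lemma quadratic_budget n m a d :
  a <= n -> d <= 2 * m -> a * (a - 2) <= d -> (m = 0 \/ 0 < n) ->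
  (0 < m -> (a + 1) * (n * (a + 1) + d + 1) <= 20 * (n * m)) /\
  (m = 0 -> (a + 1) * (n * (a + 1) + d + 1) <= 20 * n.+1).
Proof.
move=> an dm ad mn; split=> [m0|m0].
  have n0 : 0 < n by case: mn; lia.
  (* For [a >= 3], [a <= a * (a - 2) <= 2 * m] gives [a * a <= 6 * m], and
     [(a + 1) * (a + 1) <= 10 * m + 1]; for smaller [a] the square is at most 9. *)
  have a2 : (a + 1) * (a + 1) <= 11 * m.
    have [a3|a3] := ltnP a 3; first by nia.
    have : a <= a * (a - 2) by rewrite leq_pmulr; lia.
    have : a * a = a * (a - 2) + 2 * a by nia.
    nia.
  have h1 : n * ((a + 1) * (a + 1)) <= n * (11 * m) by rewrite leq_mul2l a2 orbT.
  have h2 : (a + 1) * (d + 1) <= (2 * n) * (3 * m) by apply: leq_mul; lia.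
  nia.
have d0 : d = 0 by lia.
have a2 : a <= 2 by nia.
nia.
Qed.

Theorem theorem6p5 :
  exists (P : program) (C : nat),
    forall (n : nat) (G : sgraph 'I_n) (K Mbar S M : {set 'I_n})
           (adj : 'I_n -> seq 'I_n),
      maya_tupi G ->
      MT_partition G K Mbar S M ->
      adjacency_lists G adj ->
      let m := #|edges G| in
      exists (t : nat) (s : state),
        [/\ exec P (input_state adj K Mbar S M) t s,
            optimal_coloring G (output_coloring s),
            0 < m -> t <= C * (n * m)
          & m = 0 -> t <= C * n.+1].
Proof.
(* The factor 2000 comes from the run of the program, 20 from [quadratic_budget]. *)
exists optimal_coloring_program, (2000 * 20) => n G K Mbar S M adj _ mt adjP m.
set lab := labels K Mbar S M; set s := input_state adj K Mbar S M.
have sa a : a < 3 -> arr s a =1 nth 0 (input_array adj lab a) by [].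
have s4 i : arr s 4 i = 0 by rewrite /= nth_nil.
have [t [s' [ex tT opt]]] := runs_optimal_coloring adjP (mt_core_class mt)
  (mt_core_split mt) (mt_outer_edge mt) (mt_matched mt) (erefl : reg s 0 = n)
  erefl erefl sa s4.
have [] := @quadratic_budget n m #|core n lab| (\sum_x size (adj x)).
- by rewrite -[n in _ <= n]card_ord max_card.
- exact: sum_degrees.
- exact/(sum_core_degrees adjP)/(mt_core_class mt).
- have [m0|m0] := posnP m; [by left | right].
  by case/card_gt0P: m0 => e /imsetP[p _ _]; apply: leq_ltn_trans (ltn_ord p.1).
move=> b1 b0; exists t, s'; split=> // m0; rewrite (leq_trans tT) // -mulnA leq_mul2l.
  exact: b1.
exact: b0.
Qed.
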